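(* Let $n\to\infty$ and consider the complete graph $K_n$ on vertex set $\{1,\dots,n\}$. To each edge $e$ of $K_n$ assign a length $w(e)$ and a cost $c(e)$, where all the random variables $w(e),c(e)$ ($e\in E(K_n)$) are independent and uniformly distributed on $[0,1]$. Let $\mathcal P$ be the set of paths from vertex $1$ to vertex $2$ in $K_n$, and for $P\in\mathcal P$ let $w(P)=\sum_{e\in P}w(e)$ and $c(P)=\sum_{e\in P}c(e)$. Let $c_0=c_0(n)$ be a budget satisfying \[ \frac{1}{\sqrt 2}\,\frac{\log^2 n}{n}\le c_0\le \frac{1}{2\sqrt 2}. \] Let $L_n=\min\{w(P): P\in\mathcal P,\ c(P)\le c_0\}$ and let $H_n$ be the number of edges of a path attaining this minimum. Then with probability tending to $1$ as $n\to\infty$, \[ L_n\approx \frac{\log^2 n}{4c_0 n}\qquad\text{and}\qquad H_n\approx\frac{\log n}{2}. \]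
   Context: Notation: $A_n\lesssim B_n$ means $A_n\le(1+o(1))B_n$ as $n\to\infty$; $A_n\gtrsim B_n$ means $A_n\ge (1+o(1))B_n$; $A_n\approx B_n$ means both $A_n\lesssim B_n$ and $A_n\gtrsim B_n$. For random quantities, a statement such as ''$L_n\approx B_n$ with probability tending to 1'' means there is a deterministic sequence $\varepsilon_n\to 0$ such that $\mathbb P(|L_n/B_n-1|\le \varepsilon_n)\to 1$. $\log$ is the natural logarithm. *)

(* Defs.v *)
From mathcomp Require Export all_boot all_order all_algebra.
From mathcomp Require Export all_classical all_reals all_analysis.

Set Implicit Arguments.
Unset Strict Implicit.
Unset Printing Implicit Defensive.

Export Order.TTheory GRing.Theory Num.Theory.
Export numFieldNormedType.Exports.

Local Open Scope classical_set_scope.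
Local Open Scope ring_scope.

Definition edge (n : nat) : finType := {e : {set 'I_n} | #|e| == 2%N}.

(* A path is the sequence of its vertices, which are pairwise distinct;
   consecutive vertices are automatically adjacent in the complete graph.
   The vertices 1, 2, ..., n are the elements 0, 1, ..., n.-1 of 'I_n, so the
   endpoints 1 and 2 are those of values 0 and 1; for n < 2 there is no path. *)
Definition is_path12 (n : nat) (p : seq 'I_n) : bool :=
  if p is x :: q
  then [&& nat_of_ord x == 0%N, nat_of_ord (last x q) == 1%N & uniq p]
  else false.

Definition path_edges (n : nat) (p : seq 'I_n) : {set edge n} :=
  [set e : edge n |
     val e \in [seq [set xy.1; xy.2]%SET | xy <- zip p (behead p)]]%SET.

Definition path_sum (R : realType) (n : nat) (f : edge n -> R)
    (p : seq 'I_n) : R :=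
  \sum_(e in path_edges p) f e.

Definition feasible (R : realType) (n : nat) (c : edge n -> R) (b : R)
  : set (seq 'I_n) :=
  [set p | is_path12 p /\ path_sum c p <= b].

(* There are finitely many paths, so this infimum is a minimum as soon as some
   path is feasible; it is +oo otherwise. *)
Definition min_length (R : realType) (n : nat) (w c : edge n -> R) (b : R)
  : \bar R :=
  ereal_inf [set (path_sum w p)%:E | p in feasible c b].

Definition optimal (R : realType) (n : nat) (w c : edge n -> R) (b : R)
  : set (seq 'I_n) :=
  [set p | feasible c b p /\ (path_sum w p)%:E = min_length w c b].

Definition mutually_independent (R : realType) (d : measure_display)
    (T : measurableType d) (P : probability T R) (I : finType)
    (X : I -> {RV P >-> R}) : Prop :=
  forall (J : {set I}) (A : I -> set R),
    (forall i, measurable (A i)) ->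
    P (\bigcap_(i in [set` J]) (X i @^-1` A i)) =
    (\prod_(i in J) P (X i @^-1` A i))%E.

Definition uniform01 (R : realType) (d : measure_display)
    (T : measurableType d) (P : probability T R) (X : {RV P >-> R}) : Prop :=
  forall A : set R, measurable A ->
    distribution P X A = uniform_prob (@ltr01 R) A.

Definition sum_family (I J V : Type) (X : I -> V) (Y : J -> V) (k : I + J) : V :=
  match k with inl i => X i | inr j => Y j end.

(* The event on which |L / B - 1| <= eps, with L the minimum length, and
   |H / K - 1| <= eps, with H the number of edges of any optimal path.  Its
   first condition forces L to be finite when B > 0, so that an optimal path
   then exists. *)
Definition approx_event (R : realType) (d : measure_display)
    (T : measurableType d) (P : probability T R) (n : nat)
    (w c : edge n -> {RV P >-> R}) (b B K eps : R) : set T :=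
  [set x | let wx := fun e => w e x in
           let cx := fun e => c e x in
     (`| min_length wx cx b * (B^-1)%:E - 1 | <= eps%:E)%E /\
     forall p, optimal wx cx b p -> `| #|path_edges p|%:R / K - 1 | <= eps].

(* Main.v *)
(* Everything is reduced to a finite product space by cutting [0, 1] into n^2
   cells: W(P), C(P) denote the discretised length and cost of a path P, and
   l = ln n, B = l^2 / (4 c0 n).

   No path is too short, and no short path has an atypical number k of edges:
   for lam, mu > 0 and real h, the expected number of paths P with
   lam W(P) + mu C(P) - h k <= s is, by Markov's inequality for the exponential,
   at most e^s n^(-1) sum_k (n e^h / (lam mu))^k up to discretisation errors.
   Taking lam * length = mu c0 = y l / 2 with y slightly below 1 (and h = 0), or
   y = 1 +- eps (and h close to 2 ln y), makes this a negative power of n.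

   A good path exists: consider Z = sum_P prod_(e in P) f_e over paths with m + 2
   edges, m ~ l / 2, where f_e = exp(- lam w_e - mu c_e) on inner edges, while
   f_e only requires w_e and c_e to be a small fraction of the budgets on the
   first and last edge; Z is restricted to paths whose inner length and cost
   are close to their means L0, C0 under the tilted law.  The tilted law makes
   this restriction cost a negligible part of the mean (Chernoff bounds), and on
   such paths f^2 is at most e^(-2m(1-d)) f, which controls the diagonal P = Q.
   For P <> Q, E[Z_P Z_Q] / (E Z_P)^2 is n^(m+2) times a product over the edges of
   Q of 1/n off P and of E f_e^2 / (n (E f_e)^2) on P; summing over Q is a
   transfer recursion for walks that must leave P at least once.  The factor is
   at most 4/9 on inner edges and tends to 0 on the two terminal edges, so that
   the sum is 1 + o(1), and Chebyshev's inequality applies. *)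
Require Import Defs.
From mathcomp Require Import measurable_realfun ring lra zify.

Set Implicit Arguments.
Unset Strict Implicit.
Unset Printing Implicit Defensive.

Local Open Scope ring_scope.

(** * Averages over a finite probability space *)

Section FiniteAverage.
Variable R : realType.

Definition avg (U : finType) (F : U -> R) : R := (\sum_u F u) / #|U|%:R.

Definition pr (U : finType) (Q : U -> Prop) : R := avg (fun u => (`[< Q u >])%:R).

Lemma avgE (U : finType) (F G : U -> R) : F =1 G -> avg F = avg G.
Proof. by move=> FG; congr (_ / _); apply: eq_bigr => u _; exact: FG. Qed.

Lemma ler_avg (U : finType) (F G : U -> R) :
  (forall u, F u <= G u) -> avg F <= avg G.
Proof.
by move=> FG; rewrite ler_wpM2r ?invr_ge0 ?ler0n// ler_sum.
Qed.

Lemma avg_ge0 (U : finType) (F : U -> R) : (forall u, 0 <= F u) -> 0 <= avg F.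
Proof. by move=> F0; rewrite divr_ge0 ?ler0n ?sumr_ge0. Qed.

Lemma avgD (U : finType) (F G : U -> R) :
  avg (fun u => F u + G u) = avg F + avg G.
Proof. by rewrite /avg big_split mulrDl. Qed.

Lemma avgZ (U : finType) (a : R) (F : U -> R) :
  avg (fun u => a * F u) = a * avg F.
Proof. by rewrite /avg -mulr_sumr mulrA. Qed.

Lemma avg_sum (U : finType) (I : Type) (r : seq I) (P : pred I) (F : I -> U -> R) :
  avg (fun u => \sum_(i <- r | P i) F i u) = \sum_(i <- r | P i) avg (F i).
Proof. by rewrite /avg exchange_big mulr_suml. Qed.

Lemma avg_cst (U : finType) (a : R) : (0 < #|U|)%N -> avg (fun _ : U => a) = a.
Proof.
move=> U0; rewrite /avg sumr_const -[a *+ _]mulr_natr mulfK//.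
by rewrite pnatr_eq0 -lt0n.
Qed.

Lemma avg_pair (U V : finType) (F : U -> R) (G : V -> R) :
  avg (fun z : U * V => F z.1 * G z.2) = avg F * avg G.
Proof.
rewrite /avg card_prod natrM invfM mulrACA; congr (_ * _).
rewrite mulr_suml (eq_bigr (fun i => \sum_j F i * G j)) => [|i _]; last first.
  by rewrite mulr_sumr.
by rewrite pair_big.
Qed.

Lemma avg_prod (E Z : finType) (F : E -> Z -> R) :
  avg (fun u : {ffun E -> Z} => \prod_e F e (u e)) = \prod_e avg (F e).
Proof.
rewrite /avg -(bigA_distr_bigA F) prodf_div; congr (_ / _).
by rewrite card_ffun prodr_const natrX.
Qed.

Lemma avg_prod_in (E Z : finType) (A : {set E}) (F : E -> Z -> R) :
  (0 < #|Z|)%N ->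
  avg (fun u : {ffun E -> Z} => \prod_(e in A) F e (u e)) =
  \prod_(e in A) avg (F e).
Proof.
move=> Z0.
pose G e z := if e \in A then F e z else 1.
rewrite (avgE (G := fun u : {ffun E -> Z} => \prod_e G e (u e))) => [|u]; last first.
  by rewrite /G -big_mkcond.
rewrite avg_prod [RHS]big_mkcond; apply: eq_bigr => e _.
by rewrite /G; case: ifP => // _; rewrite avg_cst.
Qed.

Lemma pr_le_avg (U : finType) (Q : U -> Prop) (F : U -> R) :
  (forall u, 0 <= F u) -> (forall u, Q u -> 1 <= F u) -> pr Q <= avg F.
Proof.
move=> F0 F1; apply: ler_avg => u; case: asboolP => // Qu; exact: F1.
Qed.

Lemma le_pr (U : finType) (Q Q' : U -> Prop) :
  (forall u, Q u -> Q' u) -> pr Q <= pr Q'.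
Proof.
move=> QQ'; apply: pr_le_avg => u; first by rewrite ler0n.
by move=> /QQ' Qu; rewrite asboolT.
Qed.

Lemma prU (U : finType) (Q Q' : U -> Prop) :
  pr (fun u => Q u \/ Q' u) <= pr Q + pr Q'.
Proof.
rewrite -avgD; apply: pr_le_avg => u; first by rewrite addr_ge0 ?ler0n.
by case=> H; rewrite (asboolT H) ?lerDl ?lerDr ler0n.
Qed.

Lemma prC (U : finType) (Q : U -> Prop) :
  (0 < #|U|)%N -> pr Q = 1 - pr (fun u => ~ Q u).
Proof.
move=> U0; apply/eqP; rewrite -subr_eq opprK -avgD; apply/eqP.
rewrite -[RHS](avg_cst 1 U0); apply: avgE => u /=.
by rewrite asbool_neg; case: asboolP => _ /=; rewrite ?addr0 ?add0r.
Qed.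

(** Where [F] vanishes, [(F - a)^2 / a^2] equals 1, with [a] the mean of [F]; Markov's inequality is
    applied to this quotient, whose mean is the relative variance. *)
Lemma chebyshev_pr0 (U : finType) (F : U -> R) : (0 < #|U|)%N ->
  0 < avg F -> pr (fun u => F u = 0) <= avg (fun u => F u ^+ 2) / avg F ^+ 2 - 1.
Proof.
move=> U0 a0; set a := avg F in a0 *.
have an0 : a != 0 by rewrite gt_eqF.
have varE : avg (fun u => (F u - a) ^+ 2) = avg (fun u => F u ^+ 2) - a ^+ 2.
  rewrite (avgE (G := fun u => F u ^+ 2 + ((- 2 * a) * F u + a ^+ 2))) => [|u].
    by rewrite avgD avgD avgZ avg_cst// -/a; ring.
  by ring.
have -> : avg (fun u => F u ^+ 2) / a ^+ 2 - 1 =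
    avg (fun u => a ^- 2 * (F u - a) ^+ 2).
  by rewrite avgZ varE; field.
apply: pr_le_avg => u; first by rewrite mulr_ge0 ?sqr_ge0// invr_ge0 sqr_ge0.
by move=> ->; rewrite sub0r sqrrN mulVf// expf_neq0.
Qed.

End FiniteAverage.

(** * Laplace transform of the discretised uniform law *)

Section Laplace.
Variables (R : realType) (N : nat).
Hypothesis N0 : (0 < N)%N.

(** Each cell of [0, 1] is represented by its left endpoint, so this is a left Riemann sum. *)
Definition laplace (lam : R) : R :=
  avg (fun a : 'I_N => expR (- lam * (a%:R / N%:R))).

Let q (lam : R) := expR (- lam / N%:R).

Let NR : 0 < N%:R :> R. Proof. by rewrite ltr0n. Qed.

(** Geometric sum of ratio [q lam], kept as a product to avoid dividing by [1 - q lam]. *)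
Lemma laplaceE (lam : R) : (1 - q lam) * laplace lam = (1 - expR (- lam)) / N%:R.
Proof.
have -> : laplace lam = (\sum_(i < N) q lam ^+ i) / N%:R.
  rewrite /laplace /avg card_ord; congr (_ / _); apply: eq_bigr => i _.
  by rewrite /q -expRM_natl; congr expR; rewrite -mulr_natl; ring.
rewrite mulrA; congr (_ / _).
have := subrX1 (q lam) N => qN.
have -> : expR (- lam) = q lam ^+ N.
  rewrite /q -expRM_natl; congr expR; rewrite -mulr_natl.
  by field; rewrite gt_eqF.
by rewrite -[1 - q lam ^+ N]opprB qN; ring.
Qed.

Lemma laplace_ge0 (lam : R) : 0 <= laplace lam.
Proof. by apply: avg_ge0 => a; rewrite expR_ge0. Qed.

Let q_lt1 (lam : R) : 0 < lam -> q lam < 1.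
Proof. by move=> l0; rewrite /q expR_lt1 mulNr oppr_lt0 divr_gt0. Qed.

(** Since [e^t >= 1 + t], [1 - q lam] is at least [1 - 1 / (1 + lam / N)], and this times
    [1 / lam + 1 / N] is exactly [1 / N]. *)
Lemma laplace_le (lam : R) : 0 < lam -> laplace lam <= lam^-1 + N%:R^-1.
Proof.
move=> l0; have t0 : 0 < lam / N%:R by rewrite divr_gt0.
have qle : q lam <= (1 + lam / N%:R)^-1.
  by rewrite /q mulNr expRN lef_pV2 ?posrE ?expR_gt0 ?expR_ge1Dx// addr_gt0.
have q1 : 0 < 1 - q lam by rewrite subr_gt0 q_lt1.
rewrite -(ler_pM2l q1) laplaceE.
apply: le_trans (_ : N%:R^-1 <= _).
  by rewrite ler_piMl ?invr_ge0 ?ler0n// gerBl expR_ge0.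
apply: le_trans (_ : (1 - (1 + lam / N%:R)^-1) * (lam^-1 + N%:R^-1) <= _); last first.
  by rewrite ler_wpM2r ?lerB// addr_ge0 ?invr_ge0 ?ltW.
rewrite le_eqVlt; apply/orP; left; apply/eqP; field.
by rewrite !gt_eqF// addr_gt0.
Qed.

(** The left Riemann sum of a decreasing function dominates its integral; in formulas,
    [1 - q lam <= lam / N]. *)
Lemma laplace_ge (lam : R) : 0 < lam -> (1 - expR (- lam)) / lam <= laplace lam.
Proof.
move=> l0; have q1 : 0 < 1 - q lam by rewrite subr_gt0 q_lt1.
rewrite -(ler_pM2l q1) (laplaceE lam).
have -> : (1 - q lam) * ((1 - expR (- lam)) / lam) =
    (1 - expR (- lam)) * ((1 - q lam) / lam) by ring.
have e1 : 0 <= 1 - expR (- lam) by rewrite subr_ge0 expR_le1 oppr_le0 ltW.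
rewrite ler_wpM2l //.
rewrite ler_pdivrMr// mulrC.
by have := expR_ge1Dx (- lam / N%:R); rewrite -/(q lam) mulNr; lra.
Qed.

Lemma laplace_gt0 (lam : R) : 0 < lam -> 0 < laplace lam.
Proof.
move=> l0; apply: lt_le_trans (laplace_ge l0).
by rewrite divr_gt0// subr_gt0 expR_lt1 oppr_lt0.
Qed.

(** The quotient is exactly [(1 + e^(-lam)) / (1 + q lam)], at most [(5/4) / (15/8)] here. What
    matters is that the square [4/9] of the bound stays below 1/2: a path vertex has two neighbours,
    and [8/9 < 1] makes the walk recursion contract. *)
Lemma laplace_double (lam : R) : 0 < lam -> lam <= N%:R / 8 -> expR (- lam) <= 1 / 4 ->
  laplace (2 * lam) <= 2 / 3 * laplace lam.
Proof.
move=> l0 l8 e4; have q1 : 0 < 1 - q lam by rewrite subr_gt0 q_lt1.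
have q8 : 7 / 8 <= q lam.
  apply: le_trans (expR_ge1Dx _); rewrite mulNr.
  have : lam / N%:R <= 1 / 8 by rewrite ler_pdivrMr// mulrC mulrA mulr1.
  by lra.
have q2 : q (2 * lam) = q lam ^+ 2.
  by rewrite /q -expRM_natl; congr expR; rewrite -mulr_natl; ring.
have e2 : expR (- (2 * lam)) = expR (- lam) ^+ 2.
  by rewrite -expRM_natl; congr expR; rewrite -mulr_natl; ring.
have L2 : (1 + q lam) * laplace (2 * lam) = (1 + expR (- lam)) * laplace lam.
  apply: (mulfI (x := 1 - q lam)); first by rewrite gt_eqF.
  have := laplaceE (2 * lam); rewrite q2 e2.
  have -> : 1 - q lam ^+ 2 = (1 - q lam) * (1 + q lam) by ring.
  move=> H; rewrite [LHS]mulrA H [RHS]mulrCA (laplaceE lam).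
  by ring.
have H1 : (1 + 7 / 8) * laplace (2 * lam) <= (1 + q lam) * laplace (2 * lam).
  by rewrite ler_wpM2r ?laplace_ge0// lerD2l.
have H2 : (1 + expR (- lam)) * laplace lam <= (1 + 1 / 4) * laplace lam.
  by rewrite ler_wpM2r ?laplace_ge0// lerD2l.
lra.
Qed.

End Laplace.

(** * Edges of a path *)

Section Steps.
Variable T : eqType.

Definition steps (p : seq T) : seq (T * T) := zip p (behead p).

Lemma stepsP (p : seq T) (u v : T) : uniq p ->
  ((u, v) \in steps p) = [&& u \in p, v \in p & index v p == (index u p).+1].
Proof.
case: p => [//|x p] up.
have sz : size (steps (x :: p)) = size p by rewrite size_zip/=; lia.
have nthE i : (i < size p)%N ->
    nth (x, x) (steps (x :: p)) i = (nth x (x :: p) i, nth x (x :: p) i.+1).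
  by move=> ip; rewrite nth_zip_cond sz ip.
apply/(nthP (x, x))/and3P => [[i]|[pu pv /eqP iv]].
  rewrite sz => ip; rewrite nthE// => -[<- <-].
  have i1 : (i < size (x :: p))%N by rewrite ltnW.
  have i2 : (i.+1 < size (x :: p))%N by [].
  by split; [exact: (mem_nth x i1)|exact: (mem_nth x i2)|rewrite -[nth x p i]/(nth x (x :: p) i.+1) !index_uniq].
have ip : (index u (x :: p) < size p)%N by have := pv; rewrite -index_mem iv.
by exists (index u (x :: p)); rewrite ?sz// nthE// -iv !nth_index.
Qed.

Lemma size_steps (p : seq T) : size (steps p) = (size p).-1.
Proof. by rewrite size_zip size_behead; lia. Qed.

End Steps.

Section Edges.
Variable n : nat.
Hypothesis n2 : (1 < n)%N.

Let v0 : 'I_n := Ordinal (ltnW n2).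
Let v1 : 'I_n := Ordinal n2.
Let v01 : #|[set v0; v1]%SET| == 2%N. Proof. by rewrite cards2. Qed.

(** Made total by a default edge on the diagonal, so that path sums become sums over consecutive
    pairs of vertices. *)
Definition edge_of (xy : 'I_n * 'I_n) : edge n :=
  insubd (Sub [set v0; v1]%SET v01 : edge n) [set xy.1; xy.2]%SET.

Lemma val_edge_of (xy : 'I_n * 'I_n) : xy.1 != xy.2 ->
  val (edge_of xy) = [set xy.1; xy.2]%SET.
Proof. by move=> xy12; rewrite val_insubd cards2 xy12. Qed.

Lemma edge_of_eq (x y u v : 'I_n) : x != y -> u != v ->
  (edge_of (x, y) == edge_of (u, v)) = ((x, y) == (u, v)) || ((x, y) == (v, u)).
Proof.
move=> xy uv; rewrite -val_eqE !val_edge_of//=.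
apply/eqP/orP => [E|[/eqP[-> ->]|/eqP[-> ->]]//]; last by rewrite finset.setUC.
have := set21 x y; have := set22 x y; rewrite E !inE => /orP[]/eqP yE /orP[]/eqP xE.
- by rewrite xE yE eqxx in xy.
- by right; rewrite xE yE.
- by left; rewrite xE yE.
- by rewrite xE yE eqxx in xy.
Qed.

Lemma edge_ofC (x y : 'I_n) : edge_of (x, y) = edge_of (y, x).
Proof. by rewrite /edge_of; congr (insubd _ _); exact: finset.setUC. Qed.

Lemma steps_neq (p : seq 'I_n) xy : uniq p -> xy \in steps p -> xy.1 != xy.2.
Proof.
case: xy => x y up; rewrite stepsP// => /and3P[_ _ /eqP xy] /=.
by apply/eqP => E; rewrite E in xy; lia.
Qed.

Definition adjacent (p : seq 'I_n) (u v : 'I_n) : bool :=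
  [&& u \in p, v \in p &
    (index v p == (index u p).+1) || (index u p == (index v p).+1)].

Lemma adjacent_sym p u v : adjacent p u v = adjacent p v u.
Proof. by rewrite /adjacent orbC andbCA. Qed.

Lemma mem_path_edges (p : seq 'I_n) (e : edge n) : uniq p ->
  (e \in path_edges p) = (e \in [seq edge_of xy | xy <- steps p]).
Proof.
move=> up; rewrite inE; apply/mapP/mapP => -[xy xyp E]; exists xy => //.
  by apply/val_inj; rewrite E val_edge_of// (steps_neq up).
by rewrite E val_edge_of// (steps_neq up).
Qed.

Lemma edge_of_path (p : seq 'I_n) (u v : 'I_n) : uniq p -> u != v ->
  (edge_of (u, v) \in path_edges p) = adjacent p u v.
Proof.
move=> up uv; rewrite mem_path_edges//; apply/mapP/idP => [[[x y] xyp /eqP]|].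
  have := steps_neq up xyp => /= xy.
  rewrite edge_of_eq// => /orP[]/eqP[-> ->]; move: xyp; rewrite stepsP// => /and3P[xp yp H].
    by rewrite /adjacent xp yp H.
  by rewrite /adjacent xp yp H orbT.
case/and3P => pu pv /orP[]H.
  by exists (u, v) => //; rewrite stepsP// pu pv.
by exists (v, u); [rewrite stepsP// pu pv | rewrite edge_ofC].
Qed.

(** Two steps with the same edge are equal or reversed, and in the reversed case each of the two
    vertices would precede the other in [p]. *)
Lemma uniq_path_edges (p : seq 'I_n) : uniq p ->
  uniq [seq edge_of xy | xy <- steps p].
Proof.
move=> up; rewrite map_inj_in_uniq; first exact: zip_uniql.
move=> [x y] [u v] xyp uvp /eqP; rewrite edge_of_eq ?(steps_neq up xyp) ?(steps_neq up uvp)//.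
case/orP => /eqP// -[xE yE]; move: xyp uvp; rewrite !stepsP// xE yE.
by move=> /and3P[_ _ /eqP A] /and3P[_ _ /eqP B]; lia.
Qed.

Lemma big_path_edges (R : Type) (idx : R) (op : Monoid.com_law idx)
    (p : seq 'I_n) (F : edge n -> R) : uniq p ->
  \big[op/idx]_(e in path_edges p) F e = \big[op/idx]_(xy <- steps p) F (edge_of xy).
Proof.
move=> up; transitivity (\big[op/idx]_(e in [seq edge_of xy | xy <- steps p]) F e).
  by apply: eq_bigl => e; rewrite mem_path_edges.
by rewrite -big_uniq ?uniq_path_edges// big_map.
Qed.

Lemma card_path_edges (p : seq 'I_n) : uniq p -> #|path_edges p| = (size p).-1.
Proof.
move=> up; rewrite -sum1_card big_path_edges// big_const_seq count_predT.
by rewrite iter_addn_0 mul1n size_steps.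
Qed.

End Edges.

(** * First moment *)

Section FirstMoment.
Variables (R : realType) (n N : nat).
Hypotheses (n2 : (1 < n)%N) (N0 : (0 < N)%N).
Let Omega : finType := {ffun edge n -> 'I_N * 'I_N}.

Definition grid_w (u : Omega) (e : edge n) : R := (u e).1%:R / N%:R.
Definition grid_c (u : Omega) (e : edge n) : R := (u e).2%:R / N%:R.

Let v0 : 'I_n := Ordinal (ltnW n2).
Let v1 : 'I_n := Ordinal n2.

(** Paths are coded by their inner vertices, so those with [j] inner vertices are among the [n^j]
    tuples of length [j]. *)
Definition path_of (t : seq 'I_n) : seq 'I_n := v0 :: rcons t v1.

Lemma is_path12_path_of t : is_path12 (path_of t) = uniq (path_of t).
Proof. by rewrite /is_path12 /path_of last_rcons. Qed.

Lemma is_path12P p : is_path12 p ->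
  exists2 t, p = path_of t & uniq (path_of t) /\ (size t < n)%N.
Proof.
case: p => [//|x q] /and3P[/eqP x0 /eqP l1 uq].
have xE : x = v0 by apply/val_inj.
case/lastP: q => [|t y] in l1 uq *; first by rewrite /= x0 in l1.
rewrite last_rcons in l1; have yE : y = v1 by apply/val_inj.
subst x y; exists t => //; split=> //.
by have := uniq_leq_size uq (fun z _ => mem_enum 'I_n z); rewrite size_enum_ord /= size_rcons => /ltnW.
Qed.

Lemma card_path_of t : uniq (path_of t) -> #|path_edges (path_of t)| = (size t).+1.
Proof. by move=> ut; rewrite card_path_edges//= size_rcons. Qed.

Lemma card_pair_ord_gt0 : (0 < #|{: 'I_N * 'I_N}|)%N.
Proof. by rewrite card_prod card_ord muln_gt0 N0. Qed.

Lemma avg_expR_grid (A : {set edge n}) (lam mu h : R) :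
  avg (fun u : Omega => expR (h * #|A|%:R - lam * (\sum_(e in A) grid_w u e)
    - mu * (\sum_(e in A) grid_c u e))) =
  (expR h * laplace N lam * laplace N mu) ^+ #|A|.
Proof.
pose F (z : 'I_N * 'I_N) := expR (h - lam * (z.1%:R / N%:R) - mu * (z.2%:R / N%:R)).
rewrite (avgE (G := fun u : Omega => \prod_(e in A) F (u e))) => [|u]; last first.
  rewrite -expR_sum; congr expR.
  by rewrite !sumrB sumr_const -!mulr_sumr mulr_natr.
rewrite (avg_prod_in A (fun _ => F)) ?card_pair_ord_gt0// prodr_const; congr (_ ^+ _).
rewrite -mulrA -avg_pair -avgZ; apply: avgE => z.
by rewrite /F -!expRD; congr expR; ring.
Qed.

(** Exponential Markov inequality and union bound. A path with [j] inner vertices has [j + 1] edges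
    and there are at most [n^j] such paths, so they contribute at most [n^j q^(j+1) = r^(j+1) / n]
    with [q = r / n]; this is summed as a geometric series. *)
Lemma pr_energy_le (lam mu h s : R) :
  let r := n%:R * (expR h * (lam^-1 + N%:R^-1) * (mu^-1 + N%:R^-1)) in
  0 < lam -> 0 < mu -> r < 1 ->
  pr R (fun u : Omega => exists2 p, is_path12 p &
    lam * path_sum (grid_w u) p + mu * path_sum (grid_c u) p
      - h * #|path_edges p|%:R <= s) <= expR s / n%:R / (1 - r).
Proof.
move=> r l0 m0 r1.
have n0 : 0 < n%:R :> R by rewrite ltr0n ltnW.
pose G (t : seq 'I_n) (u : Omega) := let A := path_edges (path_of t) in
  expR (h * #|A|%:R - lam * (\sum_(e in A) grid_w u e)
    - mu * (\sum_(e in A) grid_c u e)).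
pose F u := expR s * \sum_(j < n) \sum_(t : j.-tuple 'I_n | uniq (path_of t)) G t u.
have G0 t u : 0 <= G t u by rewrite expR_ge0.
apply: le_trans (_ : avg F <= _).
  apply: pr_le_avg => u.
    by rewrite mulr_ge0 ?expR_ge0// sumr_ge0// => j _; rewrite sumr_ge0.
  case=> p /is_path12P[t -> [ut tn]] H.
  rewrite /F (bigD1 (Ordinal tn))//= (bigD1 (in_tuple t))//=.
  apply: le_trans (_ : expR s * G t u <= _); last first.
    rewrite ler_wpM2l ?expR_ge0// -addrA lerDl addr_ge0 ?sumr_ge0// => j _.
    by rewrite sumr_ge0.
  rewrite -expRD -[leLHS]expR0 ler_expR.
  by move: H; rewrite /path_sum; lra.
rewrite avgZ avg_sum -mulrA ler_wpM2l ?expR_ge0//.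
apply: le_trans (_ : \sum_(j < n) n%:R^-1 * r ^+ j <= _); last first.
  rewrite -mulr_sumr ler_wpM2l ?invr_ge0 ?ler0n//.
  have r0 : 0 <= r.
    by rewrite !mulr_ge0 ?expR_ge0 ?addr_ge0 ?invr_ge0 ?ler0n// ltW.
  rewrite -[leRHS]mul1r ler_pdivlMr ?subr_gt0// mulrC.
  by rewrite -opprB mulNr -subrX1 opprB gerBl exprn_ge0.
apply: ler_sum => j _; rewrite avg_sum.
set q := expR h * (lam^-1 + N%:R^-1) * (mu^-1 + N%:R^-1) in r r1 *.
have q0 : 0 <= q.
  by rewrite !mulr_ge0 ?expR_ge0 ?addr_ge0 ?invr_ge0 ?ler0n// ltW.
apply: le_trans (_ : \sum_(t : j.-tuple 'I_n | uniq (path_of t)) q ^+ j.+1 <= _).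
  apply: ler_sum => t ut.
  rewrite avg_expR_grid card_path_of// size_tuple lerXn2r ?nnegrE//.
    by apply: mulr_ge0 (laplace_ge0 _ _); apply: mulr_ge0 (laplace_ge0 _ _); exact: expR_ge0.
  apply: ler_pM; rewrite ?laplace_ge0 ?laplace_le//.
    by apply: mulr_ge0 (laplace_ge0 _ _); exact: expR_ge0.
  by rewrite ler_wpM2l ?expR_ge0 ?laplace_le.
apply: le_trans (_ : \sum_(t : j.-tuple 'I_n) q ^+ j.+1 <= _).
  by rewrite big_mkcond ler_sum// => t _; case: ifP => // _; rewrite exprn_ge0.
rewrite sumr_const card_tuple card_ord -[_ *+ (n ^ j)%N]mulr_natl natrX.
have -> : n%:R ^+ j * q ^+ j.+1 = n%:R^-1 * r ^+ j.+1.
  rewrite /r [(n%:R * q) ^+ _]exprMn [n%:R ^+ j.+1]exprSr.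
  by field; rewrite gt_eqF.
rewrite ler_wpM2l ?invr_ge0 ?ler0n//.
have r0 : 0 <= r by apply: mulr_ge0 q0; rewrite ler0n.
by rewrite exprS ler_piMl ?exprn_ge0// ltW.
Qed.

End FirstMoment.

(** * Weighted sums over walks *)

Lemma big_tupleS (R : nmodType) (V : finType) (j : nat) (P : pred (seq V)) (F : seq V -> R) :
  \sum_(t : j.+1.-tuple V | P t) F t =
  \sum_(v : V) \sum_(t : j.-tuple V | P (v :: t)) F (v :: t).
Proof.
rewrite pair_big_dep /=.
rewrite (reindex (fun vt : V * j.-tuple V => [tuple of vt.1 :: vt.2])) //=.
exists (fun t => (thead t, [tuple of behead t])) => [[v t]|t] _ /=.
  by congr pair; apply/val_inj.
by rewrite [RHS](tuple_eta t); apply/val_inj.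
Qed.

Section WalkSums.
Variables (R : realType) (V : finType) (adj : rel V) (rho : V -> V -> R).
Variables (delta : R) (z : V).

(** [adj] will be adjacency along a fixed path P, [rho] the relative second moment of a shared edge,
    and [delta = 1 / n] the weight of a step off P. *)
Definition walk_step (u v : V) : R := if adj u v then rho u v else delta.

Definition walk_weight (u : V) (t : seq V) : R :=
  \prod_(xy <- steps (u :: rcons t z)) walk_step xy.1 xy.2.

Definition stays (u : V) (t : seq V) : bool :=
  all (fun xy => adj xy.1 xy.2) (steps (u :: rcons t z)).

Lemma walk_weight0 u : walk_weight u [::] = walk_step u z.
Proof. by rewrite /walk_weight /steps/= big_seq1. Qed.

Lemma walk_weightS u v t : walk_weight u (v :: t) = walk_step u v * walk_weight v t.
Proof. by rewrite /walk_weight /steps/= big_cons. Qed.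

(** [X] weighs all walks from [u] to [z] through [j] vertices, [X'] only those that leave P; [p] is
    the matrix of the steps along P. *)
Let X j u : R := \sum_(t : j.-tuple V) walk_weight u t.
Let X' j u : R := \sum_(t : j.-tuple V | ~~ stays u t) walk_weight u t.
Let B j := \sum_u X j u.
Let p u v : R := if adj u v then rho u v else 0.

(** [S] holds the vertices of P and [kappa] bounds the weight of jumping into it; [r] bounds the row
    and column sums of [p], with a separate bound [rho1] at the two endpoints [u0] and [z]. *)
Variables (S : {set V}) (r rho1 kappa : R) (u0 : V).
Hypothesis rho_ge0 : forall u v, 0 <= rho u v.
Hypothesis delta_ge0 : 0 <= delta.
Hypothesis delta_card : delta * #|V|%:R <= 1.
Hypothesis adjS : forall u v, adj u v -> (u \in S) && (v \in S).
Hypothesis deltaS : delta * #|S|%:R <= kappa.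
Hypothesis r_le : r <= 8 / 9.
Hypothesis row_le : forall u, \sum_v p u v <= r.
Hypothesis col_le : forall v, \sum_u p u v <= r.
Hypothesis row_u0 : \sum_v p u0 v <= rho1.
Hypothesis col_z : \sum_u p u z <= rho1.

Let Y j := \sum_(u in S) X j u.

Let p_ge0 u v : 0 <= p u v. Proof. by rewrite /p; case: ifP. Qed.
Let step_ge0 u v : 0 <= walk_step u v. Proof. by rewrite /walk_step; case: ifP. Qed.
Let step_le u v : walk_step u v <= p u v + delta.
Proof. by rewrite /walk_step /p; case: ifP; rewrite ?add0r ?lerDl. Qed.
Let weight_ge0 u t : 0 <= walk_weight u t. Proof. exact: prodr_ge0. Qed.
Let X_ge0 j u : 0 <= X j u. Proof. exact: sumr_ge0. Qed.
Let B_ge0 j : 0 <= B j. Proof. exact: sumr_ge0. Qed.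
Let Y_ge0 j : 0 <= Y j. Proof. exact: sumr_ge0. Qed.
Let rho1_ge0 : 0 <= rho1. Proof. exact: le_trans (sumr_ge0 _ _) row_u0. Qed.
Let r_ge0 : 0 <= r. Proof. exact: le_trans (sumr_ge0 _ _) (row_le u0). Qed.
Let kappa_ge0 : 0 <= kappa.
Proof. by apply: le_trans deltaS; rewrite mulr_ge0. Qed.

Let XS j u : X j.+1 u = \sum_v walk_step u v * X j v.
Proof.
rewrite /X (big_tupleS j xpredT (walk_weight u)).
by apply: eq_bigr => v _; rewrite mulr_sumr; apply: eq_bigr => t _; rewrite walk_weightS.
Qed.

Let big_tuple0 (F : seq V -> R) (P : pred (seq V)) :
  \sum_(t : 0.-tuple V | P t) F t = if P [::] then F [::] else 0.
Proof.
rewrite big_mkcond (bigD1 [tuple of [::]])//= big1 ?addr0// => t.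
by case/eqP; apply/val_inj; rewrite (tuple0 t).
Qed.

Let X0 u : X 0 u = walk_step u z.
Proof. by rewrite /X (big_tuple0 _ xpredT) walk_weight0. Qed.

(* Jumps contribute [delta] per target and path steps at most [r]. *)
Let sum_step_le (A : pred V) (a : R) j : delta * #|A|%:R <= a ->
  \sum_(u in A) X j.+1 u <= a * B j + r * Y j.
Proof.
move=> Aa; under eq_bigr do rewrite XS.
rewrite exchange_big/=.
apply: le_trans (_ : \sum_v (a * X j v + (if v \in S then r * X j v else 0)) <= _).
  apply: ler_sum => v _; rewrite -mulr_suml.
  have H : \sum_(u in A) walk_step u v <= a + \sum_u p u v.
    apply: le_trans (ler_sum _ (fun u _ => step_le u v)) _.
    rewrite big_split/= addrC lerD//; first by rewrite sumr_const -[_ *+ _]mulr_natr.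
    by rewrite [leRHS](bigID A)/= lerDl sumr_ge0.
  apply: le_trans (ler_wpM2r (X_ge0 j v) H) _.
  rewrite mulrDl lerD2l; case: ifPn => vS; first by rewrite ler_wpM2r.
  rewrite big1 ?mul0r// => u _; rewrite /p; case: ifP => // /adjS.
  by rewrite (negPf vS) andbF.
by rewrite big_split/= -big_mkcond/= -!mulr_sumr.
Qed.

Let sum_step0 (A : pred V) (a : R) : delta * #|A|%:R <= a ->
  \sum_(u in A) X 0 u <= a + rho1.
Proof.
move=> Aa; under eq_bigr do rewrite X0.
apply: le_trans (ler_sum _ (fun u _ => step_le u z)) _.
rewrite big_split/= addrC lerD//; first by rewrite sumr_const -[_ *+ _]mulr_natr.
by apply: le_trans col_z; rewrite [leRHS](bigID A)/= lerDl sumr_ge0.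
Qed.

Let cardT_le : delta * #|(xpredT : pred V)|%:R <= 1.
Proof. exact: delta_card. Qed.

Let bound j := (1 + 8 * kappa) ^+ j * (1 + 8 * kappa + 9 * rho1).

(* With [r <= 8/9], the potential [B + 8 Y] grows by a factor [1 + 8 kappa] only. *)
Let potential j : B j + 8 * Y j <= bound j.
Proof.
elim: j => [|j IH].
  (* The two bounds add up to [(1 + rho1) + 8 (kappa + rho1)]. *)
  have := sum_step0 cardT_le; have := sum_step0 deltaS.
  by rewrite /bound expr0 mul1r -/(Y 0) -/(B 0); lra.
have := sum_step_le j cardT_le; have := sum_step_le j deltaS.
rewrite -/(Y j.+1) -/(B j.+1) mul1r => HY HB.
apply: le_trans (_ : (1 + 8 * kappa) * (B j + 8 * Y j) <= _); last first.
  by rewrite /bound exprS -mulrA ler_wpM2l// addr_ge0// mulr_ge0.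
have H1 : r * Y j <= 8 / 9 * Y j by rewrite ler_wpM2r.
have H2 : 0 <= kappa * Y j by rewrite mulr_ge0.
lra.
Qed.

Let bound_le i j : (i <= j)%N -> bound i <= bound j.
Proof.
move=> ij; have k1 : 1 <= 1 + 8 * kappa by rewrite lerDl mulr_ge0.
by rewrite ler_wpM2r ?ler_weXn2l// !addr_ge0 ?mulr_ge0.
Qed.

Let bound_ge1 j : 1 <= bound j.
Proof.
apply: le_trans (bound_le (leq0n j)); rewrite /bound expr0 mul1r -addrA lerDl.
by rewrite addr_ge0 ?mulr_ge0.
Qed.

Let B_le i j : (i <= j)%N -> B i <= bound j.
Proof.
move=> ij; apply: le_trans (bound_le ij); apply: le_trans (potential i).
by rewrite lerDl mulr_ge0.
Qed.

(** After a first step along P the rest of the walk still has to leave P; after a jump it is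
    unconstrained. *)
Let X'S j u : X' j.+1 u <= \sum_v p u v * X' j v + delta * B j.
Proof.
rewrite /X' (big_tupleS j (fun t => ~~ stays u t) (walk_weight u)) mulr_sumr -big_split/=.
apply: ler_sum => v _; rewrite /p.
under eq_bigr do rewrite walk_weightS.
rewrite -mulr_sumr /walk_step; have := X_ge0 j v; case: ifP => uv X0j.
  rewrite ler_wpDr ?mulr_ge0// ler_wpM2l//; rewrite le_eqVlt; apply/orP; left; apply/eqP.
  by apply: eq_bigl => t; rewrite /stays /steps/= uv.
rewrite mul0r add0r ler_wpM2l//.
by rewrite /X big_mkcond ler_sum// => t _; case: ifP.
Qed.

Let X'0 u : X' 0 u <= delta.
Proof.
rewrite /X' (big_tuple0 _ (fun t => ~~ stays u t)) /stays /steps/= andbT.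
by rewrite walk_weight0 /walk_step; case: (adj u z).
Qed.

(** The factor 9 is the fixed point of [x = 8/9 x + 1], whose two terms are those of [X'S]. *)
Let X'_le i j u : (i <= j)%N -> X' i u <= 9 * (delta * bound j).
Proof.
move=> ij.
have d0 : 0 <= delta * bound j by rewrite mulr_ge0// (le_trans _ (bound_ge1 j)).
have d1 : delta <= delta * bound j by rewrite ler_peMr.
elim: i u ij => [|i IH] u ij; first by have := X'0 u; lra.
apply: le_trans (X'S i u) _.
have H : \sum_v p u v * X' i v <= r * (9 * (delta * bound j)).
  apply: le_trans (_ : \sum_v p u v * (9 * (delta * bound j)) <= _).
    by apply: ler_sum => v _; rewrite ler_wpM2l// IH// ltnW.
  by rewrite -mulr_suml ler_wpM2r// mulr_ge0//.
have H2 : delta * B i <= delta * bound j by rewrite ler_wpM2l// B_le// ltnW.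
have H3 : r * (9 * (delta * bound j)) <= 8 / 9 * (9 * (delta * bound j)).
  by rewrite ler_wpM2r// mulr_ge0.
lra.
Qed.

(** The first step is treated apart: from [u0] the steps along P weigh at most [rho1], so 9 becomes
    [1 + 9 rho1]. For [rho1] and [j kappa] small the bound is [delta (1 + o(1))]; a bound within a
    constant factor would not suffice for Chebyshev's inequality. *)
Lemma sum_leaving_walks_le j :
  \sum_(t : j.-tuple V | ~~ stays u0 t) walk_weight u0 t <=
  (1 + 9 * rho1) * (delta * ((1 + 8 * kappa) ^+ j * (1 + 8 * kappa + 9 * rho1))).
Proof.
rewrite -/(X' j u0) -/(bound j).
have d0 : 0 <= delta * bound j by rewrite mulr_ge0// (le_trans _ (bound_ge1 j)).
have d1 : delta <= delta * bound j by rewrite ler_peMr.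
have rd : 0 <= rho1 * (delta * bound j) by rewrite mulr_ge0.
case: j d0 d1 rd => [|j] d0 d1 rd; first by have := X'0 u0; lra.
apply: le_trans (X'S j u0) _.
have H : \sum_v p u0 v * X' j v <= rho1 * (9 * (delta * bound j.+1)).
  apply: le_trans (_ : \sum_v p u0 v * (9 * (delta * bound j.+1)) <= _).
    by apply: ler_sum => v _; rewrite ler_wpM2l// X'_le.
  by rewrite -mulr_suml ler_wpM2r// mulr_ge0//.
have H2 : delta * B j <= delta * bound j.+1 by rewrite ler_wpM2l// B_le.
lra.
Qed.

End WalkSums.

(** * Paths between the two endpoints *)

Lemma steps_cons2 (T : eqType) (x y : T) (s : seq T) :
  steps [:: x, y & s] = (x, y) :: steps (y :: s).
Proof. by []. Qed.

Lemma steps_rcons (T : eqType) (x y : T) (s : seq T) :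
  steps (x :: rcons s y) = rcons (steps (x :: s)) (last x s, y).
Proof.
by elim: s x => [//|z s IH] x; rewrite rcons_cons !steps_cons2 IH.
Qed.

Lemma sum_if_le (R : realType) (V : finType) (Q : pred V) (g : V -> R) (c : R) (s : seq V) :
  0 <= c -> (forall v, Q v -> g v <= c) -> (forall v, Q v -> v \in s) ->
  \sum_v (if Q v then g v else 0) <= c * (size s)%:R.
Proof.
move=> c0 gc Qs; rewrite -big_mkcond/=.
apply: le_trans (ler_sum _ gc) _.
rewrite sumr_const -[_ *+ _]mulr_natr ler_wpM2l// ler_nat cardE.
apply: uniq_leq_size; first exact: enum_uniq.
by move=> v; rewrite mem_enum => /Qs.
Qed.

Lemma bernoulli_le (R : realType) (x : R) (j : nat) :
  0 <= x <= 1 -> 1 - j%:R * x <= (1 - x) ^+ j.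
Proof.
case/andP => x0 x1; elim: j => [|j IH]; first by rewrite expr0 mul0r subr0.
rewrite exprS; apply: le_trans (_ : (1 - x) * (1 - j%:R * x) <= _); last first.
  by rewrite ler_wpM2l// subr_ge0.
have : 0 <= j%:R * x * x by rewrite !mulr_ge0.
by rewrite -natr1; lra.
Qed.

Section PathStructure.
Variable n : nat.
Hypothesis n2 : (1 < n)%N.
Let v0 : 'I_n := Ordinal (ltnW n2).
Let v1 : 'I_n := Ordinal n2.
Notation path_of := (path_of n2).
Notation edge_of := (edge_of n2).

Definition terminal (e : edge n) : bool := (v0 \in val e) || (v1 \in val e).

Lemma terminal_edge_of x y : x != y ->
  terminal (edge_of (x, y)) = (x \in [:: v0; v1]) || (y \in [:: v0; v1]).
Proof.
move=> xy; rewrite /terminal val_edge_of//= !inE ![_ == x]eq_sym ![_ == y]eq_sym.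
by case: (x == v0) (x == v1) (y == v0) (y == v1) => [] [] [] [].
Qed.

(** With at least one inner vertex the first and last edges are distinct; they are the terminal
    ones, and the other [m] edges join inner vertices. *)
Lemma big_path_terminal (R : Type) (idx : R) (op : Monoid.com_law idx) (a b : R)
    (m : nat) (t : m.+1.-tuple 'I_n) : uniq (path_of t) ->
  \big[op/idx]_(e in path_edges (path_of t)) (if terminal e then a else b) =
  op (op a a) (iter m (op b) idx).
Proof.
move=> ut; rewrite big_path_edges//.
case/tupleP: t ut => x s ut.
have pE : path_of [tuple of x :: s] = [:: v0, x & rcons s v1] by [].
rewrite pE in ut *; move: (ut) => us.
rewrite steps_cons2 steps_rcons big_cons big_rcons/=.
have us2 : uniq (x :: s).
  by move: us => /=; rewrite rcons_uniq mem_rcons inE => /and4P[_ /norP[_ ->] _ ->].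
have v0x : v0 \notin x :: s.
  by move: us; rewrite -rcons_cons cons_uniq mem_rcons inE => /andP[/norP[]].
have v1x : v1 \notin x :: s.
  by move: us; rewrite -rcons_cons cons_uniq rcons_uniq => /and3P[].
rewrite !terminal_edge_of; first last.
- by apply: contraNneq v0x => ->; rewrite mem_head.
- by apply: contraNneq v1x => <-; rewrite mem_last.
rewrite inE eqxx/= !inE eqxx !orbT.
rewrite (eq_big_seq (fun _ => b)) => [|[y w]]; last first.
  move=> yws; have /= yw := steps_neq n2 us2 yws.
  move: yws; rewrite stepsP// => /and3P[yx wx _]; rewrite terminal_edge_of//.
  by rewrite !inE (negPf (memPn v0x y yx)) (negPf (memPn v1x y yx))
    (negPf (memPn v0x w wx)) (negPf (memPn v1x w wx)).
rewrite big_const_seq count_predT size_steps/= size_tuple.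
by rewrite Monoid.mulmA Monoid.mulmAC.
Qed.

Lemma adjacent_neq (p : seq 'I_n) u v : adjacent p u v -> u != v.
Proof.
case/and3P => _ _ H; apply/eqP => E; move: H; rewrite E orbb => /eqP.
exact: n_Sn.
Qed.

Lemma adjacentP (p : seq 'I_n) u v : adjacent p u v ->
  v = nth v0 p (index u p).+1 \/ (0 < index u p)%N /\ v = nth v0 p (index u p).-1.
Proof.
case/and3P => up vp /orP[]/eqP H; [left|right]; first by rewrite -H nth_index.
by rewrite H; split=> //=; rewrite nth_index.
Qed.

Lemma adjacent_first (t : seq 'I_n) v : adjacent (path_of t) v0 v ->
  v = nth v0 (path_of t) 1.
Proof. by move/adjacentP; rewrite /path_of index_head => -[//|[]]. Qed.

Lemma adjacent_last (t : seq 'I_n) v : uniq (path_of t) ->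
  adjacent (path_of t) v1 v -> v = nth v0 (path_of t) (size t).
Proof.
move=> ut adj; have iv : index v1 (path_of t) = (size t).+1.
  have -> : v1 = nth v0 (path_of t) (size t).+1 by rewrite /= nth_rcons ltnn eqxx.
  by rewrite index_uniq//= size_rcons.
case/and3P: adj => _ vp; rewrite iv => /orP[]/eqP H.
  by move: vp; rewrite -index_mem H /= size_rcons ltnn.
by case: H => ->; rewrite nth_index.
Qed.

(** Induction on the position: a step along the path of [t] goes to the next or to the previous
    vertex, and going back would repeat a vertex of the path of [t']. *)
Lemma path_of_eq (m : nat) (t t' : m.-tuple 'I_n) :
  uniq (path_of t) -> uniq (path_of t') ->
  stays (adjacent (path_of t)) v1 v0 t' -> t' = t.
Proof.
move=> ut ut'; rewrite /stays -/(path_of t'); set p := path_of t; set q := path_of t'.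
have sp : size p = m.+2 by rewrite /= size_rcons size_tuple.
have sq : size q = m.+2 by rewrite /= size_rcons size_tuple.
move=> /allP adj.
have nthE i : (i < m.+2)%N -> nth v0 q i = nth v0 p i.
  elim/ltn_ind: i => -[//|i] IH im.
  have qi : nth v0 q i = nth v0 p i by apply: IH => //; exact: ltnW.
  have : adjacent p (nth v0 q i) (nth v0 q i.+1).
    apply: (adj (_, _)).
    by rewrite stepsP// !mem_nth ?sq ?(ltnW im)// !index_uniq ?sq ?(ltnW im)// eqxx.
  move/adjacentP; rewrite qi index_uniq ?sp ?(ltnW im)// => -[//|[i0]].
  have [i1 im1] : (i.-1 < i.+1)%N /\ (i.-1 < m.+2)%N by lia.
  rewrite -(IH _ i1 im1).
  move/eqP; rewrite nth_uniq ?sq//; first by lia.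
have : q = p by apply: (@eq_from_nth _ v0); rewrite ?sp ?sq.
by move=> [] /rcons_inj[] tt; apply/val_inj.
Qed.

(** The count is the falling factorial of [n - 2] with [m] factors, each at least [n - (m + 2)];
    then Bernoulli's inequality. *)
Lemma card_paths_ge (R : realType) (m : nat) : (m.+2 <= n)%N ->
  n%:R ^+ m * (1 - m%:R * (m.+2%:R / n%:R)) <=
  #|[set t : m.-tuple 'I_n | uniq (path_of t)]|%:R :> R.
Proof.
move=> mn.
have -> : [set t : m.-tuple 'I_n | uniq (path_of t)] =
   [set t : m.-tuple 'I_n | all (predC (pred2 v0 v1)) t & uniq t].
  apply/setP => t; rewrite !inE /path_of /= rcons_uniq mem_rcons inE.
  have v01 : v0 == v1 = false by [].
  rewrite v01 /=.
  have -> : all (predC (pred2 v0 v1)) t = (v0 \notin tval t) && (v1 \notin tval t).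
    apply/allP/andP => [H|[a0 a1] x xt].
      by split; apply/negP => /H /=.
    by rewrite /= negb_or !(eq_sym x) (memPnC a0) ?(memPnC a1).
  by rewrite andbA.
rewrite card_uniq_tuples ffact_prod natr_prod.
have cA : #|predC (pred2 v0 v1)| = (n - 2)%N.
  have := cardC (pred2 v0 v1); rewrite card2 card_ord.
  have -> : v0 != v1 by [].
  by move=> /= H; apply/eqP; rewrite -(eqn_add2l 2) H; apply/eqP; rewrite subnKC.
rewrite cA.
have n0 : 0 < n%:R :> R by rewrite ltr0n; lia.
have xle : m.+2%:R / n%:R <= 1 :> R by rewrite ler_pdivrMr// mul1r ler_nat.
apply: le_trans (_ : \prod_(i < m) (n%:R * (1 - m.+2%:R / n%:R)) <= _).
  rewrite prodr_const card_ord exprMn ler_wpM2l ?exprn_ge0//.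
  by apply: bernoulli_le; rewrite divr_ge0.
apply: ler_prod => i _; rewrite mulr_ge0 ?subr_ge0//=.
rewrite mulrBr mulr1 mulrCA divff ?gt_eqF// mulr1 -natrB// ler_nat.
by have := ltn_ord i; lia.
Qed.

End PathStructure.

(** * Second moment *)

Section SecondMoment.
Variables (R : realType) (n N m : nat).
Hypotheses (n2 : (1 < n)%N) (N0 : (0 < N)%N).
Let Omega : finType := {ffun edge n -> 'I_N * 'I_N}.
Let v0 : 'I_n := Ordinal (ltnW n2).
Let v1 : 'I_n := Ordinal n2.
Notation path_of := (path_of n2).
Notation edge_of := (edge_of n2).
Notation terminal := (terminal n2).
Variables (a b : R).

Definition light (z : 'I_N * 'I_N) : R :=
  ((z.1%:R / N%:R <= a) && (z.2%:R / N%:R <= b))%:R.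

Definition edge_weight (lam mu : R) (e : edge n) (z : 'I_N * 'I_N) : R :=
  if terminal e then light z
  else expR (- lam * (z.1%:R / N%:R)) * expR (- mu * (z.2%:R / N%:R)).

Definition path_weight lam mu (t : seq 'I_n) (u : Omega) : R :=
  \prod_(e in path_edges (path_of t)) edge_weight lam mu e (u e).

Definition inner_w (t : seq 'I_n) (u : Omega) : R :=
  \sum_(e in path_edges (path_of t) | ~~ terminal e) grid_w R u e.
Definition inner_c (t : seq 'I_n) (u : Omega) : R :=
  \sum_(e in path_edges (path_of t) | ~~ terminal e) grid_c R u e.
Definition light_ends (t : seq 'I_n) (u : Omega) : R :=
  \prod_(e in path_edges (path_of t) | terminal e) light (u e).

Let p1 : R := avg light.

Lemma light_ends01 t u : light_ends t u = 0 \/ light_ends t u = 1.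
Proof.
rewrite /light_ends; elim/big_ind: _ => [|x y|e _]; first by right.
  by case=> [->|->] [->|->]; rewrite ?mul0r ?mul1r; by [left|right].
by rewrite /light; case: (_ && _); [right|left].
Qed.

Lemma path_weightE lam mu t u :
  path_weight lam mu t u =
  light_ends t u * expR (- lam * inner_w t u - mu * inner_c t u).
Proof.
rewrite /path_weight (bigID terminal)/=; congr (_ * _).
  by apply: eq_bigr => e /andP[_ te]; rewrite /edge_weight te.
rewrite (eq_bigr (fun e => expR (- lam * grid_w R u e - mu * grid_c R u e))).
  by rewrite -expR_sum sumrB -!mulr_sumr.
by move=> e /andP[_ /negPf te]; rewrite /edge_weight te -expRD mulNr [- mu * _]mulNr.
Qed.

Lemma path_weight_ge0 lam mu t u : 0 <= path_weight lam mu t u.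
Proof.
by rewrite path_weightE mulr_ge0 ?expR_ge0//; case: (light_ends01 t u) => ->.
Qed.

Lemma path_weight_tilt lam mu lam' mu' h g t u :
  lam' = lam - h -> mu' = mu - g ->
  path_weight lam' mu' t u =
  expR (h * inner_w t u + g * inner_c t u) * path_weight lam mu t u.
Proof. by move=> -> ->; rewrite !path_weightE mulrCA -expRD; congr (_ * expR _); ring. Qed.

Lemma avg_edge_weight lam mu e :
  avg (edge_weight lam mu e) =
  if terminal e then p1 else laplace N lam * laplace N mu.
Proof.
by rewrite /edge_weight; case: ifP => // _; rewrite -avg_pair.
Qed.

(** Squaring doubles the tilt on inner edges and fixes the indicator on terminal ones. *)
Lemma avg_edge_weight_sq lam mu e :
  avg (fun z => edge_weight lam mu e z ^+ 2) =
  if terminal e then p1 else laplace N (2 * lam) * laplace N (2 * mu).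
Proof.
rewrite /edge_weight; case: ifP => // _.
  by apply: avgE => z; rewrite /light; case: (_ && _); rewrite ?expr0n ?expr1n.
rewrite -avg_pair; apply: avgE => z /=.
by rewrite -!expRD -expRM_natl; congr expR; rewrite -mulr_natl; ring.
Qed.

Lemma avg_path_weight lam mu (t : m.+1.-tuple 'I_n) : uniq (path_of t) ->
  avg (path_weight lam mu t) = p1 ^+ 2 * (laplace N lam * laplace N mu) ^+ m.
Proof.
move=> ut; rewrite /path_weight avg_prod_in ?card_pair_ord_gt0//.
under eq_bigr do rewrite avg_edge_weight.
by rewrite big_path_terminal//= iter_mulr_1 -expr2.
Qed.

Variables (lam mu : R).
Hypotheses (lam0 : 0 < lam) (mu0 : 0 < mu).
(** [p0] and [s0] are the first two moments of an inner edge weight, [pi] is the mean weight of a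
    path, and [rate e] is the relative second moment of an edge weight divided by [n]. *)
Let p0 : R := laplace N lam * laplace N mu.
Let s0 : R := laplace N (2 * lam) * laplace N (2 * mu).
Let W := path_weight lam mu.
Let pi : R := p1 ^+ 2 * p0 ^+ m.
Let pbar e : R := if terminal e then p1 else p0.
Let sbar e : R := if terminal e then p1 else s0.
Let rate e : R := sbar e / (n%:R * pbar e ^+ 2).
Hypothesis p1_gt0 : 0 < p1.

Let nR : 0 < n%:R :> R. Proof. by rewrite ltr0n ltnW. Qed.
Let p0_gt0 : 0 < p0. Proof. by apply: mulr_gt0; exact: laplace_gt0. Qed.
Let pbar_gt0 e : 0 < pbar e. Proof. by rewrite /pbar; case: ifP. Qed.

Let cross t := walk_weight (adjacent (path_of t))
  (fun x y => rate (edge_of (x, y))) n%:R^-1 v1 v0.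

(** Let P and Q be the paths of [t] and [t']. By independence an edge of just one of them
    contributes [pbar e], a shared one [sbar e = pbar e * pbar e * n * rate e]. Extracting [pi] for
    each path and [n] for each of the [m + 2] edges of Q leaves the walk weight of Q relative to
    P. *)
Lemma avg_path_weightM (t t' : m.+1.-tuple 'I_n) :
  uniq (path_of t) -> uniq (path_of t') ->
  avg (fun u => W t u * W t' u) = pi ^+ 2 * n%:R ^+ m.+2 * cross t t'.
Proof.
move=> ut ut'; set A := path_edges (path_of t); set A' := path_edges (path_of t').
pose G e z : R := (if e \in A then edge_weight lam mu e z else 1) *
  (if e \in A' then edge_weight lam mu e z else 1).
rewrite (avgE (G := fun u : Omega => \prod_e G e (u e))) => [|u]; last first.
  by rewrite /W /path_weight -/A -/A' [X in X * _]big_mkcond [X in _ * X]big_mkcond -big_split.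
rewrite avg_prod.
pose H e : R := (if e \in A then pbar e else 1) * ((if e \in A' then pbar e else 1) *
  (if e \in A' then n%:R * (if e \in A then rate e else n%:R^-1) else 1)).
have HE e : avg (G e) = H e.
  have pe := pbar_gt0 e; rewrite /G /H.
  case: ifP => eA; case: ifP => eA'.
  - transitivity (sbar e); first exact: (avg_edge_weight_sq lam mu e).
    by rewrite /rate; field; rewrite !gt_eqF.
  - under avgE do rewrite mulr1.
    by rewrite avg_edge_weight !mulr1.
  - under avgE do rewrite mul1r.
    by rewrite avg_edge_weight divff ?gt_eqF// mul1r mulr1.
  - by rewrite !mulr1 avg_cst ?card_pair_ord_gt0.
rewrite (eq_bigr H)//.
rewrite !big_split/= -!big_mkcond/= big_split/= prodr_const card_path_of// size_tuple.
have prodA (s : m.+1.-tuple 'I_n) : uniq (path_of s) ->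
    \prod_(e in path_edges (path_of s)) pbar e = pi.
  by move=> us; rewrite big_path_terminal//= iter_mulr_1 -expr2.
rewrite !prodA// expr2 !mulrA; congr (_ * _).
rewrite big_path_edges// /cross /walk_weight -/(path_of t').
apply: eq_big_seq => -[x y] xy; have /= xyn := steps_neq n2 ut' xy.
by rewrite /walk_step edge_of_path.
Qed.

(** Under the tilted law inner lengths are roughly exponential of rate [lam], so [m] of them sum to
    about [m / lam = L0]; likewise for costs and [C0]. The four inequalities are Chernoff bounds per
    edge for a relative deviation [d], with gain [kappa]. *)
Variables (kappa d L0 C0 theta : R).
Hypotheses (lamL : lam * L0 = m%:R) (muC : mu * C0 = m%:R).
Hypothesis theta0 : 0 <= theta.
Hypothesis up_w : expR (- (theta * (1 + d))) * laplace N ((1 - theta) * lam) <= kappa * laplace N lam.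
Hypothesis lo_w : expR (theta * (1 - d)) * laplace N ((1 + theta) * lam) <= kappa * laplace N lam.
Hypothesis up_c : expR (- (theta * (1 + d))) * laplace N ((1 - theta) * mu) <= kappa * laplace N mu.
Hypothesis lo_c : expR (theta * (1 - d)) * laplace N ((1 + theta) * mu) <= kappa * laplace N mu.

Definition balanced (t : seq 'I_n) (u : Omega) : bool :=
  ((1 - d) * L0 <= inner_w t u <= (1 + d) * L0) &&
  ((1 - d) * C0 <= inner_c t u <= (1 + d) * C0).

Let tilt_le (x y s l l' : R) (t : m.+1.-tuple 'I_n) : uniq (path_of t) ->
  expR x * (laplace N l * laplace N l') <= kappa * p0 ->
  avg (fun u => expR (m%:R * x) * path_weight l l' t u) <= kappa ^+ m * pi.
Proof.
move=> ut H; rewrite avgZ avg_path_weight// mulrCA [leRHS]mulrCA ler_wpM2l ?sqr_ge0//.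
rewrite expRM_natl -!exprMn lerXn2r ?nnegrE//.
  by apply: mulr_ge0 (expR_ge0 _) _; apply: mulr_ge0; exact: laplace_ge0.
apply: le_trans H; apply: mulr_ge0 (expR_ge0 _) _.
by apply: mulr_ge0; exact: laplace_ge0.
Qed.

(* Markov's inequality under four exponential tilts of the weight. *)
Lemma avg_unbalanced (t : m.+1.-tuple 'I_n) : uniq (path_of t) ->
  avg (fun u => W t u * (~~ balanced t u)%:R) <= 4 * (kappa ^+ m * pi).
Proof.
move=> ut.
pose T1 u := expR (m%:R * - (theta * (1 + d))) * path_weight ((1 - theta) * lam) mu t u.
pose T2 u := expR (m%:R * (theta * (1 - d))) * path_weight ((1 + theta) * lam) mu t u.
pose T3 u := expR (m%:R * - (theta * (1 + d))) * path_weight lam ((1 - theta) * mu) t u.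
pose T4 u := expR (m%:R * (theta * (1 - d))) * path_weight lam ((1 + theta) * mu) t u.
have T1E u : T1 u = W t u * expR (theta * lam * (inner_w t u - (1 + d) * L0)).
  rewrite /T1 (@path_weight_tilt lam mu _ _ (theta * lam) (0)) ?subr0//; last by ring.
  rewrite mulrA -expRD mulrC.
  by congr (_ * expR _); rewrite -lamL; ring.
have T2E u : T2 u = W t u * expR (theta * lam * ((1 - d) * L0 - inner_w t u)).
  rewrite /T2 (@path_weight_tilt lam mu _ _ (- (theta * lam)) (0)) ?subr0//; last by ring.
  rewrite mulrA -expRD mulrC.
  by congr (_ * expR _); rewrite -lamL; ring.
have T3E u : T3 u = W t u * expR (theta * mu * (inner_c t u - (1 + d) * C0)).
  rewrite /T3 (@path_weight_tilt lam mu _ _ (0) (theta * mu)) ?subr0//; last by ring.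
  rewrite mulrA -expRD mulrC.
  by congr (_ * expR _); rewrite -muC; ring.
have T4E u : T4 u = W t u * expR (theta * mu * ((1 - d) * C0 - inner_c t u)).
  rewrite /T4 (@path_weight_tilt lam mu _ _ (0) (- (theta * mu))) ?subr0//; last by ring.
  rewrite mulrA -expRD mulrC.
  by congr (_ * expR _); rewrite -muC; ring.
apply: le_trans (_ : avg (fun u => T1 u + T2 u + T3 u + T4 u) <= _).
  apply: ler_avg => u; rewrite T1E T2E T3E T4E -!mulrDr ler_wpM2l ?path_weight_ge0//.
  have E1 (x y z : R) : 0 <= x -> y <= z -> 1 <= expR (x * (z - y)).
    by move=> x0 yz; rewrite -expR0 ler_expR mulr_ge0// subr_ge0.
  have tl : 0 <= theta * lam by rewrite mulr_ge0// ltW.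
  have tm : 0 <= theta * mu by rewrite mulr_ge0// ltW.
  case: (boolP (balanced t u)) => /=; first by rewrite !addr_ge0 ?expR_ge0.
  rewrite /balanced !negb_and -!ltNge.
  set X1 := expR _; set X2 := expR _; set X3 := expR _; set X4 := expR _.
  have := expR_ge0 (theta * lam * (inner_w t u - (1 + d) * L0)).
  have := expR_ge0 (theta * lam * ((1 - d) * L0 - inner_w t u)).
  have := expR_ge0 (theta * mu * (inner_c t u - (1 + d) * C0)).
  have := expR_ge0 (theta * mu * ((1 - d) * C0 - inner_c t u)).
  rewrite -/X1 -/X2 -/X3 -/X4 => x4 x3 x2 x1.
  case/orP => /orP[]/ltW H.
  - by have := E1 _ _ _ tl H; rewrite -/X2; lra.
  - by have := E1 _ _ _ tl H; rewrite -/X1; lra.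
  - by have := E1 _ _ _ tm H; rewrite -/X4; lra.
  - by have := E1 _ _ _ tm H; rewrite -/X3; lra.
rewrite !avgD.
have H1 : avg T1 <= kappa ^+ m * pi.
  by apply: tilt_le => //; rewrite /p0 [leLHS]mulrA [leRHS]mulrA ler_wpM2r// laplace_ge0.
have H2 : avg T2 <= kappa ^+ m * pi.
  by apply: tilt_le => //; rewrite /p0 [leLHS]mulrA [leRHS]mulrA ler_wpM2r// laplace_ge0.
have H3 : avg T3 <= kappa ^+ m * pi.
  by apply: tilt_le => //; rewrite /p0 [leLHS]mulrCA [leRHS]mulrCA ler_wpM2l// laplace_ge0.
have H4 : avg T4 <= kappa ^+ m * pi.
  by apply: tilt_le => //; rewrite /p0 [leLHS]mulrCA [leRHS]mulrCA ler_wpM2l// laplace_ge0.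
lra.
Qed.

(** Balance gives [lam * inner_w + mu * inner_c >= 2 m (1 - d)], which bounds one of the two factors
    of the square. *)
Lemma balanced_sq_le t u : balanced t u ->
  W t u ^+ 2 <= expR (- (2 * m%:R * (1 - d))) * W t u.
Proof.
case/andP => /andP[wl _] /andP[cl _].
rewrite expr2 ler_wpM2r ?path_weight_ge0// /W path_weightE.
apply: le_trans (_ : 1 * expR (- lam * inner_w t u - mu * inner_c t u) <= _).
  by rewrite ler_wpM2r ?expR_ge0//; case: (light_ends01 t u) => ->.
rewrite mul1r ler_expR.
have H1 := ler_wpM2l (ltW lam0) wl; have H2 := ler_wpM2l (ltW mu0) cl.
rewrite mulrCA lamL in H1; rewrite mulrCA muC in H2.
lra.
Qed.

Hypothesis s0_le : s0 <= 4 / 9 * p0.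
Hypothesis np0 : 1 <= n%:R * p0.
Hypothesis np1 : 9 / 4 <= n%:R * p1.
Let rho1 : R := (n%:R * p1)^-1.

Let rho1_le : rho1 <= 4 / 9.
Proof.
have -> : 4 / 9 = (9 / 4)^-1 :> R by rewrite invf_div.
by rewrite /rho1 lef_pV2// posrE ?divr_gt0// mulr_gt0.
Qed.

Let rho1_ge0 : 0 <= rho1. Proof. by rewrite invr_ge0 ltW// mulr_gt0. Qed.

Let rate_terminal e : terminal e -> rate e = rho1.
Proof. by rewrite /rate /sbar /pbar /rho1 => ->; field; rewrite !gt_eqF. Qed.

Let s0_ge0 : 0 <= s0. Proof. by apply: mulr_ge0; exact: laplace_ge0. Qed.

Let rate_ge0 e : 0 <= rate e.
Proof.
apply: divr_ge0; first by rewrite /sbar; case: ifP => // _; exact: ltW.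
by apply: mulr_ge0; [exact: ltW|exact: sqr_ge0].
Qed.

Let rate_le e : rate e <= 4 / 9.
Proof.
have [te|te] := boolP (terminal e); first by rewrite rate_terminal.
rewrite /rate /sbar /pbar (negPf te) ler_pdivrMr; last first.
  by apply: mulr_gt0 => //; exact: exprn_gt0.
apply: le_trans s0_le _; rewrite ler_wpM2l ?divr_ge0//.
by rewrite expr2 mulrA ler_peMl// ltW.
Qed.

(** [kap] is the proportion of the [m + 3] vertices of P among all, and [D] the bound of the walk
    recursion with [delta = 1 / n] factored out. *)
Let kap : R := m.+3%:R / n%:R.
Let D : R := (1 + 9 * rho1) * ((1 + 8 * kap) ^+ m.+1 * (1 + 8 * kap + 9 * rho1)).

(** By [path_of_eq] a path other than P leaves P, and the sum is enlarged to all walks that do. A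
    vertex has at most two neighbours along P, of rate at most [4/9], and an endpoint just one,
    through a terminal edge of rate [rho1]. *)
Lemma sum_cross_le (t : m.+1.-tuple 'I_n) : uniq (path_of t) ->
  \sum_(t' : m.+1.-tuple 'I_n | uniq (path_of t') && (t' != t)) cross t t' <=
  n%:R^-1 * D.
Proof.
move=> ut; set p := path_of t.
apply: le_trans (_ : \sum_(t' : m.+1.-tuple 'I_n | ~~ stays (adjacent p) v1 v0 t')
    cross t t' <= _).
  rewrite big_mkcond [leRHS]big_mkcond; apply: ler_sum => t' _.
  have c0 : 0 <= cross t t'.
    by apply: prodr_ge0 => xy _; rewrite /walk_step; case: ifP; rewrite ?invr_ge0.
  case: ifP => [/andP[ut' tt']|_]; last by case: ifP.
  by rewrite ifT//; apply: contra tt' => st; apply/eqP; exact: path_of_eq st.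
have rowE (u : 'I_n) (c : R) (s : seq 'I_n) : 0 <= c ->
    (forall v, adjacent p u v -> rate (edge_of (u, v)) <= c) ->
    (forall v, adjacent p u v -> v \in s) ->
    \sum_v (if adjacent p u v then rate (edge_of (u, v)) else 0) <= c * (size s)%:R.
  exact: sum_if_le.
have colE u : \sum_v (if adjacent p v u then rate (edge_of (v, u)) else 0) =
    \sum_v (if adjacent p u v then rate (edge_of (u, v)) else 0).
  by apply: eq_bigr => v _; rewrite adjacent_sym edge_ofC.
have row u : \sum_v (if adjacent p u v then rate (edge_of (u, v)) else 0) <= 8 / 9.
  apply: le_trans (rowE u (4 / 9) [:: nth v0 p (index u p).+1; nth v0 p (index u p).-1] _ _ _) _.
  - by rewrite divr_ge0.
  - by move=> v _; exact: rate_le.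
  - by move=> v /adjacentP[->|[_ ->]]; rewrite !inE eqxx ?orbT.
  by rewrite /=; lra.
have row0 : \sum_v (if adjacent p v0 v then rate (edge_of (v0, v)) else 0) <= rho1.
  rewrite -[leRHS]mulr1; apply: (rowE v0 rho1 [:: nth v0 p 1]) => // v adj.
    by rewrite rate_terminal// terminal_edge_of ?(adjacent_neq adj)// !inE eqxx.
  by rewrite inE (adjacent_first adj).
have row1 : \sum_v (if adjacent p v1 v then rate (edge_of (v1, v)) else 0) <= rho1.
  rewrite -[leRHS]mulr1; apply: (rowE v1 rho1 [:: nth v0 p (size t)]) => // v adj.
    by rewrite rate_terminal// terminal_edge_of ?(adjacent_neq adj)// !inE eqxx orbT.
  by rewrite inE (adjacent_last ut adj).
have -> : n%:R^-1 * D = (1 + 9 * rho1) *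
    (n%:R^-1 * ((1 + 8 * kap) ^+ m.+1 * (1 + 8 * kap + 9 * rho1))).
  by rewrite /D mulrCA.
apply: (sum_leaving_walks_le (S := [set x in p]) (r := 8 / 9)) => //.
- by rewrite card_ord mulVf// gt_eqF.
- by move=> u v /and3P[up vp _]; rewrite !finset.in_set up vp.
- rewrite mulrC ler_wpM2r ?invr_ge0// ler_nat cardsE.
  by apply: leq_trans (card_size _) _; rewrite /= size_rcons size_tuple.
- by move=> v; rewrite colE.
- by rewrite colE.
Qed.

Hypothesis mn : (m.+3 <= n)%N.
Let beta : R := 1 - m.+1%:R * kap.
Hypothesis beta_gt0 : 0 < beta.
Hypothesis kappa_lt : 4 * kappa ^+ m < 1.

Let pi_gt0 : 0 < pi.
Proof. by apply: mulr_gt0; exact: exprn_gt0. Qed.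

(** Chebyshev's inequality for the sum [Z] of the weights restricted to balanced outcomes. The
    restriction costs the mean at most a factor [eta]; off the diagonal it is dropped and
    [sum_cross_le] applies, on the diagonal it allows [balanced_sq_le]. *)
Lemma pr_no_light_path_le :
  pr R (fun u => ~ exists t : m.+1.-tuple 'I_n,
    [/\ uniq (path_of t), balanced t u & light_ends t u = 1]) <=
  (D + n%:R * expR (- (2 * m%:R * (1 - d))) / (n%:R * p0) ^+ m) /
    (beta * (1 - 4 * kappa ^+ m) ^+ 2) - 1.
Proof.
set ex := expR _; set eta := 1 - 4 * kappa ^+ m.
have eta0 : 0 < eta by rewrite subr_gt0.
pose Xs := [set t : m.+1.-tuple 'I_n | uniq (path_of t)].
pose Zt (t : m.+1.-tuple 'I_n) u := W t u * (balanced t u)%:R.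
pose Z u := \sum_(t in Xs) Zt t u.
have Zt_ge0 t u : 0 <= Zt t u by rewrite mulr_ge0// path_weight_ge0.
have Zt_le t u : Zt t u <= W t u.
  by rewrite /Zt; case: balanced; rewrite ?mulr1 ?mulr0// path_weight_ge0.
set x : R := #|Xs|%:R.
have nm0 : 0 < n%:R ^+ m.+1 :> R by rewrite exprn_gt0.
have x_ge : n%:R ^+ m.+1 * beta <= x by exact: card_paths_ge.
have x0 : 0 < x by apply: lt_le_trans x_ge; exact: mulr_gt0.
have avgZ_ge : x * (pi * eta) <= avg Z.
  rewrite /Z avg_sum /x -sum1_card natr_sum mulr_suml; apply: ler_sum => t.
  rewrite inE mul1r => ut.
  have := avg_unbalanced ut; have := avg_path_weight lam mu ut; rewrite -/p0 -/pi => pE.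
  have : avg (path_weight lam mu t) = avg (Zt t) + avg (fun u => W t u * (~~ balanced t u)%:R).
    rewrite -avgD; apply: avgE => u; rewrite /Zt /W.
    by case: balanced; rewrite ?mulr1 ?mulr0 ?addr0 ?add0r.
  by rewrite pE /eta; lra.
have kap_ge0 : 0 <= kap by rewrite divr_ge0.
have D_ge0 : 0 <= D.
  apply: mulr_ge0; first by rewrite addr_ge0// mulr_ge0.
  by rewrite mulr_ge0 ?exprn_ge0 ?addr_ge0 ?mulr_ge0.
have np0m : 0 < (n%:R * p0) ^+ m by rewrite exprn_gt0// (lt_le_trans _ np0).
set r := n%:R * ex / (n%:R * p0) ^+ m.
have r_ge0 : 0 <= D + r.
  by rewrite addr_ge0// divr_ge0 ?(ltW np0m)// mulr_ge0 ?expR_ge0.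
have avgZ2_le : avg (fun u => Z u ^+ 2) <=
    x * (pi ^+ 2 * n%:R ^+ m.+1 * D + ex * pi).
  apply: le_trans (_ : avg (fun u => \sum_(t in Xs)
      (\sum_(t' : m.+1.-tuple 'I_n | uniq (path_of t') && (t' != t)) W t u * W t' u
        + ex * W t u)) <= _).
    apply: ler_avg => u; rewrite expr2 /Z mulr_suml; apply: ler_sum => t tX.
    rewrite mulr_sumr (bigD1 t)//= addrC lerD//.
      rewrite [leLHS](eq_bigl (fun t' : m.+1.-tuple 'I_n => uniq (path_of t') && (t' != t))).
        by apply: ler_sum => t' _; exact: ler_pM.
      by move=> t'; rewrite inE.
    rewrite -expr2 /Zt; case: (boolP (balanced t u)) => bt.
      by rewrite mulr1 balanced_sq_le.
    by rewrite mulr0 expr0n/= mulr_ge0 ?expR_ge0 ?path_weight_ge0.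
  rewrite avg_sum /x -sum1_card natr_sum mulr_suml; apply: ler_sum => t.
  rewrite inE mul1r => ut; rewrite avgD avgZ avg_path_weight// -/p0 -/pi lerD2r avg_sum.
  rewrite (eq_bigr (fun t' : m.+1.-tuple 'I_n => pi ^+ 2 * n%:R ^+ m.+2 * cross t t')).
    rewrite -mulr_sumr; apply: le_trans (ler_wpM2l _ (sum_cross_le ut)) _.
      by rewrite mulr_ge0 ?sqr_ge0 ?exprn_ge0.
    rewrite le_eqVlt; apply/orP; left; apply/eqP.
    by rewrite [n%:R ^+ m.+2]exprS; field; rewrite gt_eqF.
  by move=> t' /andP[ut' _]; rewrite avg_path_weightM.
have xpe : 0 < x * (pi * eta) by apply: mulr_gt0 => //; exact: mulr_gt0.
have avgZ0 : 0 < avg Z by exact: lt_le_trans avgZ_ge.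
apply: le_trans (_ : pr R (fun u => Z u = 0) <= _).
  apply: le_pr => u noP; rewrite /Z big1// => t; rewrite inE => ut.
  rewrite /Zt /W path_weightE; case: (light_ends01 t u) => l1; first by rewrite l1 !mul0r.
  case: (boolP (balanced t u)) => bt; last by rewrite mulr0.
  by case: noP; exists t.
apply: le_trans (chebyshev_pr0 _ avgZ0) _.
  by rewrite card_ffun card_prod card_ord expn_gt0 muln_gt0 N0.
rewrite lerD2r ler_pdivrMr ?exprn_gt0//.
apply: le_trans avgZ2_le _.
apply: le_trans (_ : (D + r) / (beta * eta ^+ 2) * (x * (pi * eta)) ^+ 2 <= _); last first.
  rewrite ler_wpM2l//; last by rewrite lerXn2r ?nnegrE// ltW.
  by rewrite divr_ge0// mulr_ge0 ?sqr_ge0// ltW.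
(* The diagonal term is measured in units of [pi n^(m+1)]; the two terminal edges give a factor
   [(n p1)^2 >= 1] to spare. *)
have pin : ex <= pi * n%:R ^+ m.+1 * r.
  have -> : pi * n%:R ^+ m.+1 * r = ex * (n%:R * p1) ^+ 2.
    rewrite /pi /r [n%:R ^+ m.+1]exprS [(n%:R * p0) ^+ m]exprMn; field.
    by rewrite !expf_neq0 ?gt_eqF.
  rewrite ler_peMr ?expR_ge0// exprn_ege1// (le_trans _ np1)//.
  by rewrite ler_pdivlMr// mul1r ler_nat.
apply: le_trans (_ : x * (pi ^+ 2 * n%:R ^+ m.+1 * (D + r)) <= _).
  rewrite ler_wpM2l ?(ltW x0)// mulrDr lerD2l mulrC.
  have := ler_wpM2l (ltW pi_gt0) pin; rewrite expr2 !mulrA; exact.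
(* One factor [x] is traded for [n^(m+1) beta], by the lower bound on the number of paths. *)
have -> : (D + r) / (beta * eta ^+ 2) * (x * (pi * eta)) ^+ 2 =
    x * (pi ^+ 2 * (x / beta) * (D + r)).
  by field; rewrite !gt_eqF.
rewrite ler_wpM2l ?(ltW x0)// ler_wpM2r// ler_wpM2l ?sqr_ge0//.
by rewrite ler_pdivlMr.
Qed.

End SecondMoment.

(** * Existence of a cheap path *)

Section Bounds.
Variable R : realType.

Lemma exprn_ge1Dmn (x : R) (j : nat) : 0 <= x -> 1 + j%:R * x <= (1 + x) ^+ j.
Proof.
move=> x0; elim: j => [|j IH]; first by rewrite expr0 mul0r addr0.
rewrite exprS; apply: le_trans (_ : (1 + x) * (1 + j%:R * x) <= _); last first.
  by rewrite ler_wpM2l// addr_ge0.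
have : 0 <= j%:R * x * x by rewrite !mulr_ge0.
by rewrite -natr1; lra.
Qed.

(** [floor x + 1] naturals are at most [x], and only those below [N] are counted. *)
Lemma ge0_le_count_ord (N : nat) (x : R) : 0 <= x <= N%:R ->
  x <= \sum_(i < N) (i%:R <= x)%R%:R.
Proof.
elim: N x => [|N IH] x /andP[x0 xN]; first by rewrite big_ord0.
rewrite big_ord_recr/=; have [Nx|xN'] := leP N%:R x.
  rewrite (eq_bigr (fun _ => 1)); last first.
    by move=> i _; rewrite (le_trans _ Nx)// ler_nat ltnW.
  by rewrite sumr_const card_ord -natr1 in xN *.
by rewrite addr0 IH// x0 ltW.
Qed.

Lemma avg_light_ge (N : nat) (a b : R) : (0 < N)%N -> 0 <= a <= 1 -> 0 <= b <= 1 ->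
  a * b <= avg (light (N := N) a b).
Proof.
move=> N0 a01 b01; have NR : 0 < N%:R :> R by rewrite ltr0n.
have H x : 0 <= x <= 1 -> x <= avg (fun i : 'I_N => (i%:R / N%:R <= x)%R%:R) :> R.
  move=> /andP[x0 x1]; rewrite /avg card_ord ler_pdivlMr//.
  have xN : 0 <= x * N%:R <= N%:R.
    by apply/andP; split; [rewrite mulr_ge0 | rewrite ler_piMl].
  apply: le_trans (ge0_le_count_ord xN) _.
  by apply: ler_sum => i _; rewrite ler_pdivrMr.
have -> : avg (light (N := N) a b) = avg (fun i : 'I_N => (i%:R / N%:R <= a)%R%:R) *
    avg (fun i : 'I_N => (i%:R / N%:R <= b)%R%:R).
  rewrite -avg_pair; apply: avgE => z.
  by rewrite /light; do 2 case: (_ <= _); rewrite ?mulr0 ?mulr1.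
by rewrite ler_pM ?H//; [case/andP: a01|case/andP: b01].
Qed.

Lemma expRN_le (x : R) : 0 <= x -> expR (- x) <= (1 + x)^-1.
Proof.
by move=> x0; rewrite expRN lef_pV2 ?posrE ?expR_gt0 ?expR_ge1Dx// ltr_wpDr.
Qed.

Lemma expR_small (x : R) : 0 <= x <= 1 / 2 -> expR x <= 1 + 2 * x.
Proof.
case/andP => x0 x2; have x1 : 0 < 1 - x by lra.
have : expR x <= (1 - x)^-1.
  rewrite -[expR x]invrK -expRN lef_pV2 ?posrE ?expR_gt0//.
  by have := expR_ge1Dx (- x); lra.
move/le_trans; apply; rewrite -div1r ler_pdivrMr//.
by have : 0 <= x * (1 - 2 * x) by [rewrite mulr_ge0//; lra]; lra.
Qed.

(* Cramer-type bounds for the exponential law, at the tilt [theta = d / 2]. *)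
Lemma tilt_up (d : R) : 0 < d <= 1 / 2 ->
  expR (- (d / 2 * (1 + d))) / (1 - d / 2) <= (1 + d ^+ 2 / 8)^-1.
Proof.
case/andP => d0 d2; rewrite expRN -invfM lef_pV2 ?posrE; first last.
- by have := sqr_ge0 d; lra.
- by rewrite mulr_gt0 ?expR_gt0//; lra.
have := expR_ge1Dx (d / 2 * (1 + d)).
have h : 0 < 1 - d / 2 by lra.
rewrite -(ler_pM2r h); apply: le_trans.
have : 0 <= d ^+ 2 * (1 / 2 - d) by rewrite mulr_ge0 ?sqr_ge0//; lra.
have := sqr_ge0 d; rewrite !expr2; lra.
Qed.

Lemma tilt_lo (d : R) : 0 < d <= 1 / 2 ->
  expR (d / 2 * (1 - d)) / (1 + d / 2) <= (1 + d ^+ 2 / 8)^-1.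
Proof.
case/andP => d0 d2; rewrite -[expR _]invrK -expRN -invfM lef_pV2 ?posrE; first last.
- by have := sqr_ge0 d; lra.
- by rewrite mulr_gt0 ?expR_gt0//; lra.
have := expR_ge1Dx (- (d / 2 * (1 - d))).
have h : 0 < 1 + d / 2 by lra.
rewrite -(ler_pM2r h); apply: le_trans.
have : 0 <= d ^+ 2 * d by rewrite mulr_ge0 ?sqr_ge0// ltW.
have := sqr_ge0 d; rewrite !expr2; lra.
Qed.

Lemma tilt_up_bounds (d : R) : 0 < d <= 1 / 2 -> 0 <= expR (- (d / 2 * (1 + d))) <= 2.
Proof.
case/andP => d0 _; rewrite expR_ge0/=; apply: (@le_trans _ _ 1); last by rewrite ler1n.
by rewrite expR_le1 oppr_le0 mulr_ge0//; lra.
Qed.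

Lemma tilt_lo_bounds (d : R) : 0 < d <= 1 / 2 -> 0 <= expR (d / 2 * (1 - d)) <= 2.
Proof.
case/andP => d0 d2; rewrite expR_ge0/=.
have dd0 : 0 <= d / 2 * (1 - d) by rewrite mulr_ge0//; lra.
have dd1 : d / 2 * (1 - d) <= 1 / 4 by have := sqr_ge0 d; rewrite expr2; lra.
by apply: le_trans (expR_small _) _; lra.
Qed.

(** For the exponential law the quotient of the two transforms would be [1 / s]; the grid and the
    cutoff at 1 perturb this by terms of order [1 / m], absorbed by weakening [d^2 / 8] to
    [d^2 / 16]. *)
Lemma laplace_tilt_le (N m : nat) (d E s lam : R) : (0 < N)%N ->
  0 < d <= 1 / 2 -> 0 <= E <= 2 -> 0 < s -> E / s <= (1 + d ^+ 2 / 8)^-1 ->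
  96 <= m%:R * d ^+ 2 -> m%:R <= lam -> lam / N%:R <= m%:R^-1 ->
  E * laplace N (s * lam) <= (1 + d ^+ 2 / 16)^-1 * laplace N lam.
Proof.
move=> N0 /andP[d0 d2] /andP[E0 E2] s0 Es md ml lN.
set h := d ^+ 2 / 8 in Es *.
have h0 : 0 < h by rewrite divr_gt0// exprn_gt0.
have h1 : h <= 1 / 32.
  have : d * d <= 1 / 2 * (1 / 2) by rewrite ler_pM// ltW.
  by rewrite /h expr2; lra.
have -> : d ^+ 2 / 16 = h / 2 by rewrite /h -mulrA -invfM; congr (_ / _); ring.
have mR : 0 < m%:R :> R.
  by rewrite ltr0n lt0n; apply: contraTneq md => ->; rewrite mul0r -ltNge.
(* The constant is [96 = 8 * 12]: three error terms [1 / m] have to fit into the gap [h / 4] of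
   [E1]. *)
have hm : m%:R^-1 <= h / 12.
  rewrite -[leLHS]mul1r ler_pdivrMr//; move: md; rewrite /h; lra.
have l0 : 0 < lam by exact: lt_le_trans ml.
have := laplace_ge N0 l0; set L := laplace N lam => Lge.
have := laplace_le N0 (mulr_gt0 s0 l0); set L' := laplace N _ => L'le.
have e1 : expR (- lam) <= m%:R^-1.
  apply: le_trans (expRN_le (ltW l0)) _; rewrite lef_pV2 ?posrE//; last by lra.
  by lra.
have H1 : E * L' <= ((1 + h)^-1 + 2 * m%:R^-1) / lam.
  apply: le_trans (ler_wpM2l E0 L'le) _.
  rewrite ler_pdivlMr//.
  have -> : E * ((s * lam)^-1 + N%:R^-1) * lam = E / s + E * (lam / N%:R).
    by field; rewrite !gt_eqF// ltr0n.
  by rewrite lerD// ler_pM// divr_ge0// ltW.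
have p2 : 0 < 1 + h / 2 by lra.
have H2 : (1 + h / 2)^-1 * ((1 - m%:R^-1) / lam) <= (1 + h / 2)^-1 * L.
  rewrite ler_wpM2l ?invr_ge0 ?(ltW p2)//.
  by apply: le_trans Lge; rewrite ler_wpM2r ?invr_ge0 ?(ltW l0)// lerB.
apply: le_trans H1 _; apply: le_trans H2.
rewrite mulrA ler_wpM2r ?invr_ge0 ?(ltW l0)//.
have p1 : 0 < 1 + h by lra.
have E1 : (1 + h)^-1 <= (1 + h / 2)^-1 - h / 4.
  rewrite -[leLHS]mul1r ler_pdivrMr//.
  have -> : ((1 + h / 2)^-1 - h / 4) * (1 + h) = 1 + h / 4 * (2 - (1 + h / 2) * (1 + h)) / (1 + h / 2).
    by field; rewrite gt_eqF//; lra.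
  have : (1 + h / 2) * (1 + h) <= (1 + 1 / 32) * (1 + 1 / 32) by rewrite ler_pM//; lra.
  move=> q; rewrite lerDl; apply: divr_ge0 (ltW p2); apply: mulr_ge0; lra.
have E2' : (1 + h / 2)^-1 * m%:R^-1 <= m%:R^-1.
  by rewrite ler_piMl ?invr_ge0 ?(ltW mR)// invf_le1//; lra.
by rewrite mulrBr mulr1; lra.
Qed.

End Bounds.

(** * Parameters of the second moment method *)

Section Existence.
Variable R : realType.

(* One side of the symmetric data [n L C = e^(4d) m^2]. *)
Lemma laplace_rate_bounds (n m : nat) (L C : R) : (0 < n)%N -> (8 <= m)%N ->
  0 < L <= 1 -> 0 < C <= 1 -> m%:R ^+ 2 <= n%:R * L * C ->
  let lam := m%:R / L in
  [/\ 0 < lam, m%:R <= lam, lam / (n ^ 2)%:R <= m%:R^-1,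
      laplace (n ^ 2) (2 * lam) <= 2 / 3 * laplace (n ^ 2) lam &
      (1 - m%:R^-1) * (L / m%:R) <= laplace (n ^ 2) lam].
Proof.
move=> n0 m8 /andP[L0 L1] /andP[C0 C1] mLC lam.
have m0 : 0 < m%:R :> R by rewrite ltr0n; lia.
have m8' : 8 <= m%:R :> R by rewrite ler_nat.
have n1 : 1 <= n%:R :> R by rewrite ler1n.
have nR : 0 < n%:R :> R by rewrite ltr0n.
have N0 : (0 < n ^ 2)%N by rewrite expn_gt0 n0.
have lam0 : 0 < lam by rewrite divr_gt0.
have ml : m%:R <= lam by rewrite ler_pdivlMr// ler_piMr// ltW.
have mL : m%:R ^+ 2 <= n%:R * L.
  by apply: le_trans mLC _; rewrite ler_piMr// mulr_ge0// ltW.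
have lN : lam / (n ^ 2)%:R <= m%:R^-1.
  rewrite -[leRHS]mul1r ler_pdivlMr// natrX.
  have -> : lam / n%:R ^+ 2 * m%:R = m%:R ^+ 2 / (n%:R * L * n%:R).
    by rewrite /lam; field; rewrite !gt_eqF.
  rewrite ler_pdivrMr ?mulr_gt0 ?mul1r// ?mulr_gt0//.
  by apply: le_trans mL _; rewrite ler_peMr// mulr_ge0// ltW.
have e1 : expR (- lam) <= m%:R^-1.
  apply: le_trans (expRN_le (ltW lam0)) _; rewrite lef_pV2 ?posrE//; last by lra.
  lra.
split => //.
  apply: laplace_double => //.
    rewrite -ler_pdivrMl ?ltr0n// mulrC; apply: le_trans lN _.
    by rewrite lef_pV2 ?posrE.
  by apply: le_trans e1 _; rewrite -[leLHS]mul1r ler_pdivrMr//; lra.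
apply: le_trans (laplace_ge N0 lam0).
rewrite [X in _ <= _ * X]invf_div; apply: ler_wpM2r; last by rewrite lerB.
by rewrite divr_ge0 ?ltW.
Qed.

(** Every error is at most [tau]. In terms of exponentials the numerator costs [9 + 8 + 17 + 1 = 35]
    multiples of [tau], and the denominator has three factors, each at least [e^(-2 tau)]. *)
Lemma second_moment_ratio_le (m : nat) (tau rho1 kap q T : R) :
  0 < tau <= 1 / 2 -> 0 <= rho1 -> rho1 <= tau -> 0 <= kap -> kap <= tau ->
  m.+1%:R * kap <= tau -> 0 <= q -> q <= tau -> T <= tau ->
  ((1 + 9 * rho1) * ((1 + 8 * kap) ^+ m.+1 * (1 + 8 * kap + 9 * rho1)) + T) /
    ((1 - m.+1%:R * kap) * (1 - q) ^+ 2) - 1 <= expR (41 * tau) - 1.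
Proof.
case/andP => t0 t2 rho1_ge0 rho1_le kap0 kapt kapm kap_ge0 kap_le T_le; rewrite lerD2r.
have D_le : (1 + 9 * rho1) * ((1 + 8 * kap) ^+ m.+1 * (1 + 8 * kap + 9 * rho1)) <= expR (34 * tau).
  have -> : 34 * tau = 9 * tau + (8 * tau + 17 * tau) by ring.
  rewrite 2!expRD; apply: ler_pM.
  - by rewrite addr_ge0// mulr_ge0.
  - by rewrite mulr_ge0 ?exprn_ge0 ?addr_ge0 ?mulr_ge0.
  - by apply: le_trans (expR_ge1Dx _); lra.
  apply: ler_pM.
  - by rewrite exprn_ge0 ?addr_ge0 ?mulr_ge0.
  - by rewrite !addr_ge0 ?mulr_ge0.
  - apply: le_trans (_ : expR (8 * kap) ^+ m.+1 <= _).
      by rewrite lerXn2r ?nnegrE ?expR_ge0 ?expR_ge1Dx// addr_ge0 ?mulr_ge0.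
    by rewrite -expRM_natl ler_expR; lra.
  by apply: le_trans (expR_ge1Dx _); lra.
have e1 : 1 <= expR (34 * tau).
  by apply: le_trans (expR_ge1Dx _); rewrite lerDl mulr_ge0// ltW.
have num : (1 + 9 * rho1) * ((1 + 8 * kap) ^+ m.+1 * (1 + 8 * kap + 9 * rho1)) + T <= expR (35 * tau).
  have -> : 35 * tau = 34 * tau + tau by ring.
  rewrite expRD; apply: le_trans (_ : expR (34 * tau) * (1 + tau) <= _); last first.
    by rewrite ler_wpM2l ?expR_ge0 ?expR_ge1Dx.
  have : tau <= expR (34 * tau) * tau by rewrite ler_peMl// ltW.
  lra.
have low x : 0 <= x -> x <= tau -> expR (- (2 * tau)) <= 1 - x.
  move=> x0 xt; apply: le_trans (expRN_le _) _; first by lra.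
  apply: le_trans (_ : 1 - tau <= _); last by lra.
  rewrite -div1r ler_pdivrMr; last by lra.
  have : 0 <= tau * (1 - 2 * tau) by rewrite mulr_ge0//; lra.
  lra.
have den : expR (- (6 * tau)) <= (1 - m.+1%:R * kap) * (1 - q) ^+ 2.
  have -> : - (6 * tau) = - (2 * tau) + (- (2 * tau) + - (2 * tau)) by ring.
  rewrite 2!expRD expr2; apply: ler_pM; rewrite ?mulr_ge0 ?expR_ge0//.
    by apply: low => //; rewrite mulr_ge0.
  by apply: ler_pM; rewrite ?expR_ge0//; apply: low.
rewrite ler_pdivrMr; last by apply: lt_le_trans den; exact: expR_gt0.
apply: le_trans num _; apply: le_trans (ler_wpM2l (expR_ge0 _) den).
by rewrite -expRD ler_expR; lra.
Qed.

(** The factor [e^(4d)] in [n L0 C0] makes [n p0] at least [e^(3d)], discretisation included. With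
    [n <= e^(2m)] this beats the diagonal: [n e^(-2m(1-d)) / (n p0)^m <= e^(-md)]. *)
Lemma pr_no_light_path_asymp (n m : nat) (n2 : (1 < n)%N) (d tau L0 C0 : R) :
  0 < d <= 1 / 2 -> 0 < tau <= 1 / 2 -> 0 < L0 <= 1 -> 0 < C0 <= 1 ->
  n%:R * L0 * C0 = expR (4 * d) * m%:R ^+ 2 ->
  n%:R <= expR (2 * m%:R) :> R -> 64 <= m%:R * (d ^+ 2 * tau) ->
  m.+3%:R ^+ 2 <= tau * n%:R ->
  pr R (fun u : {ffun edge n -> 'I_(n ^ 2) * 'I_(n ^ 2)} =>
     ~ exists t : m.+1.-tuple 'I_n,
    [/\ uniq (path_of n2 t), balanced n2 d L0 C0 t u &
        light_ends n2 (d * L0) (d * C0) t u = 1]) <= expR (41 * tau) - 1.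
Proof.
move=> d01 t01 L01 C01 nLC nm mdt mn.
case/andP: (d01) => d0 d2; case/andP: (t01) => t0 t2.
have tau1 : tau < 1 by lra.
have th1 : 0 < 1 - d / 2 by lra.
have th2 : 0 < 1 + d / 2 by lra.
case/andP: (L01) => Lp L1; case/andP: (C01) => Cp C1.
have n0 : (0 < n)%N by rewrite ltnW.
have nR : 0 < n%:R :> R by rewrite ltr0n.
have N0 : (0 < n ^ 2)%N by rewrite expn_gt0 n0.
have mR_ge0 : 0 <= m%:R :> R by rewrite ler0n.
have d2_ge0 : 0 <= m%:R * d ^+ 2 by rewrite mulr_ge0// sqr_ge0.
have md2 : 128 <= m%:R * d ^+ 2.
  have : m%:R * d ^+ 2 * tau <= m%:R * d ^+ 2 * (1 / 2) by rewrite ler_wpM2l.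
  by rewrite -mulrA; lra.
have m96 : 96 <= m%:R * d ^+ 2 by lra.
have dd : d ^+ 2 <= d / 2 by have := ler_wpM2l (ltW d0) d2; rewrite expr2; lra.
have md : 256 <= m%:R * d.
  have := ler_wpM2l mR_ge0 dd; lra.
have m512 : 512 <= m%:R :> R.
  by have := ler_wpM2l mR_ge0 d2; lra.
have m8 : (8 <= m)%N by rewrite -(ler_nat R); lra.
have mR : 0 < m%:R :> R by lra.
have e4 : 1 <= expR (4 * d) by rewrite -expR0 ler_expR mulr_ge0// ltW.
have mLC : m%:R ^+ 2 <= n%:R * L0 * C0 by rewrite nLC ler_peMl// sqr_ge0.
have mCL : m%:R ^+ 2 <= n%:R * C0 * L0 by rewrite mulrAC.
have [lam0 ml lN ldbl lge] := laplace_rate_bounds n0 m8 L01 C01 mLC.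
have [mu0 mm mN mdbl mge] := laplace_rate_bounds n0 m8 C01 L01 mCL.
set lam := m%:R / L0 in lam0 ml lN ldbl lge; set mu := m%:R / C0 in mu0 mm mN mdbl mge.
set pp0 := laplace (n ^ 2) lam * laplace (n ^ 2) mu.
have np0 : expR (3 * d) <= n%:R * pp0.
  apply: le_trans (_ : n%:R * (((1 - m%:R^-1) * (L0 / m%:R)) * ((1 - m%:R^-1) * (C0 / m%:R))) <= _).
    have -> : n%:R * (((1 - m%:R^-1) * (L0 / m%:R)) * ((1 - m%:R^-1) * (C0 / m%:R))) =
        (1 - m%:R^-1) ^+ 2 * (n%:R * L0 * C0 / m%:R ^+ 2) by field; rewrite gt_eqF.
    rewrite nLC mulfK ?expf_neq0 ?gt_eqF//.
    have -> : 3 * d = - d + 4 * d by ring.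
    rewrite expRD ler_wpM2r ?expR_ge0//.
    apply: le_trans (expRN_le (ltW d0)) _.
    have mi : m%:R^-1 <= d / 256.
      by rewrite -[leLHS]mul1r ler_pdivrMr//; clear - md; lra.
    apply: le_trans (_ : 1 - 2 * (d / 256) <= _); last first.
      by have := sqr_ge0 (m%:R^-1 : R); rewrite sqrrB; clear - mi; lra.
    rewrite -div1r ler_pdivrMr; last by clear - d0; lra.
    by rewrite expr2 in dd; clear - dd d0; lra.
  have m1 : 0 <= 1 - m%:R^-1 :> R by rewrite subr_ge0 invf_le1//; clear - m512; lra.
  by rewrite ler_wpM2l ?ler0n// ler_pM// mulr_ge0// divr_ge0// ltW.
have dL : 0 <= d * L0 <= 1.
  by rewrite mulr_ge0 ?(ltW d0) ?(ltW Lp)//= mulr_ile1 ?(ltW d0) ?(ltW Lp)//; clear - d2; lra.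
have dC : 0 <= d * C0 <= 1.
  by rewrite mulr_ge0 ?(ltW d0) ?(ltW Cp)//= mulr_ile1 ?(ltW d0) ?(ltW Cp)//; clear - d2; lra.
have p1ge := avg_light_ge N0 dL dC.
set pp1 := avg _ in p1ge.
have p1pos : 0 < pp1 by apply: lt_le_trans p1ge; apply: mulr_gt0; exact: mulr_gt0.
have np1pos : 0 < n%:R * pp1 by exact: mulr_gt0.
have np1 : m%:R ^+ 2 * d ^+ 2 <= n%:R * pp1.
  apply: le_trans (ler_wpM2l (ltW nR) p1ge).
  have -> : n%:R * (d * L0 * (d * C0)) = n%:R * L0 * C0 * d ^+ 2 by ring.
  by rewrite ler_wpM2r ?sqr_ge0.
have np1' : 128 * m%:R <= n%:R * pp1.
  by apply: le_trans np1; rewrite expr2 -mulrA mulrC ler_wpM2l.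
have taum : 64 <= m%:R * tau.
  apply: le_trans mdt _; rewrite ler_wpM2l// ler_piMl ?(ltW t0)//.
  by apply: le_trans dd _; clear - d2; lra.
set rho1 := (n%:R * pp1)^-1.
have rho1_ge0 : 0 <= rho1 by rewrite invr_ge0 ltW.
have rho1_le : rho1 <= tau.
  rewrite /rho1 -[leLHS]mul1r ler_pdivrMr//.
  have := ler_wpM2l (ltW t0) np1'; clear - taum; lra.
set kappa : R := (1 + d ^+ 2 / 16)^-1.
(* The constant 64 is chosen for [(1 + d^2 / 16)^m >= m d^2 / 16 >= 4 / tau]. *)
have kap_le : 4 * kappa ^+ m <= tau.
  rewrite /kappa exprVn ler_pdivrMr; last by rewrite exprn_gt0// addr_gt0// divr_gt0 ?exprn_gt0.
  have := @exprn_ge1Dmn R (d ^+ 2 / 16) m; rewrite divr_ge0 ?sqr_ge0// => /(_ isT) H.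
  apply: le_trans (ler_wpM2l (ltW t0) H).
  by rewrite mulrDr; clear - mdt t0; lra.
have kap_ge0 : 0 <= 4 * kappa ^+ m.
  by rewrite mulr_ge0// exprn_ge0// invr_ge0 addr_ge0// divr_ge0// sqr_ge0.
have th0 : 0 <= d / 2 by rewrite divr_ge0 ?ltW.
have up0 := tilt_up_bounds d01; have lo0 := tilt_lo_bounds d01.
set kap : R := m.+3%:R / n%:R.
have kap0 : 0 <= kap by rewrite divr_ge0.
have m3R : 1 <= m.+3%:R :> R by rewrite ler1n.
have kapm : m.+1%:R * kap <= tau.
  rewrite /kap mulrA ler_pdivrMr//; apply: le_trans mn.
  by rewrite expr2 ler_wpM2r ?ler0n// ler_nat ltnW.
have kapt : kap <= tau.
  by apply: le_trans kapm; rewrite ler_peMl// ler1n.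
have mn' : (m.+3 <= n)%N.
  rewrite -(ler_nat R); apply: le_trans (_ : tau * n%:R <= _); last first.
    by rewrite ler_piMl ?(ltW nR)// ltW.
  by apply: le_trans mn; rewrite expr2 ler_peMl ?ler0n.
have lamL : lam * L0 = m%:R by rewrite divfK ?gt_eqF.
have muC : mu * C0 = m%:R by rewrite divfK ?gt_eqF.
have s0le : laplace (n ^ 2) (2 * lam) * laplace (n ^ 2) (2 * mu) <= 4 / 9 * pp0.
  apply: le_trans (ler_pM (laplace_ge0 _ _) (laplace_ge0 _ _) ldbl mdbl) _.
  by rewrite mulrACA ler_wpM2r ?(ltW (mulr_gt0 (laplace_gt0 N0 lam0) (laplace_gt0 N0 mu0)))//; clear; lra.
have np0_1 : 1 <= n%:R * pp0.
  by apply: le_trans np0; rewrite -expR0 ler_expR mulr_ge0// ltW.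
have beta0 : 0 < 1 - m.+1%:R * kap by rewrite subr_gt0 (le_lt_trans kapm).
have np1_1 : 9 / 4 <= n%:R * pp1.
  by apply: le_trans np1'; clear -m512; lra.
have kap1 : 4 * kappa ^+ m < 1 by rewrite (le_lt_trans kap_le).
have H1 := laplace_tilt_le N0 d01 up0 th1 (tilt_up d01) m96 ml lN.
have H2 := laplace_tilt_le N0 d01 lo0 th2 (tilt_lo d01) m96 ml lN.
have H3 := laplace_tilt_le N0 d01 up0 th1 (tilt_up d01) m96 mm mN.
have H4 := laplace_tilt_le N0 d01 lo0 th2 (tilt_lo d01) m96 mm mN.
have H := pr_no_light_path_le n2 N0 lam0 mu0 p1pos lamL muC th0 H1 H2 H3 H4
  s0le np0_1 np1_1 mn' beta0 kap1.
apply: le_trans H _.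
rewrite -/pp0 -/pp1 -/rho1 -/kap.
set T := _ / (_ ^+ m).
have T_le : T <= tau.
  rewrite /T ler_pdivrMr; last by rewrite exprn_gt0// (lt_le_trans _ np0_1).
  apply: le_trans (_ : expR (2 * m%:R) * expR (- (2 * m%:R * (1 - d))) <= _).
    by rewrite ler_wpM2r ?expR_ge0.
  apply: le_trans (_ : tau * expR (3 * d) ^+ m <= _); last first.
    by rewrite ler_wpM2l ?(ltW t0)// lerXn2r ?nnegrE ?expR_ge0// (le_trans _ np0_1).
  rewrite -expRM_natl -expRD.
  have -> : 2 * m%:R + - (2 * m%:R * (1 - d)) = - (m%:R * d) + m%:R * (3 * d) by ring.
  rewrite expRD ler_wpM2r ?expR_ge0//.
  have md0 : 0 <= m%:R * d by rewrite mulr_ge0// ltW.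
  apply: le_trans (expRN_le md0) _; rewrite -div1r ler_pdivrMr; last by clear - md0; lra.
  have := ler_wpM2l (ltW d0) taum; have := ler_wpM2l (ltW t0) md.
  have : m%:R * (d ^+ 2 * tau) <= m%:R * (d / 2 * tau).
    by rewrite ler_wpM2l// ler_wpM2r ?(ltW t0).
  clear - t0 mdt; lra.
exact: second_moment_ratio_le.
Qed.

End Existence.

(** * Fitting the budget with values rounded up *)

Section CheapPath.
Variable R : realType.

Lemma sum_path_le (n m : nat) (n2 : (1 < n)%N) (t : m.+1.-tuple 'I_n)
    (g : edge n -> R) (a : R) : uniq (path_of n2 t) ->
  (forall e, e \in path_edges (path_of n2 t) -> terminal n2 e -> g e <= a) ->
  \sum_(e in path_edges (path_of n2 t)) g e <=
  2 * a + \sum_(e in path_edges (path_of n2 t) | ~~ terminal n2 e) g e.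
Proof.
move=> ut ga; rewrite (bigID (terminal n2))/= lerD2r.
apply: le_trans (_ : \sum_(e in path_edges (path_of n2 t)) (if terminal n2 e then a else 0) <= _).
  by rewrite -big_mkcondr; apply: ler_sum => e /andP[]; exact: ga.
rewrite big_path_terminal//= iter_addr addr0 mul0rn addr0.
by rewrite mulrDl mul1r.
Qed.

Lemma light_ends1 (n N : nat) (n2 : (1 < n)%N) (a b : R) (t : seq 'I_n)
    (u : {ffun edge n -> 'I_N * 'I_N}) : light_ends n2 a b t u = 1 ->
  forall e, e \in path_edges (path_of n2 t) -> terminal n2 e ->
  grid_w R u e <= a /\ grid_c R u e <= b.
Proof.
move=> l1 e eA te.
have : light_ends n2 a b t u != 0 by rewrite l1 oner_eq0.
rewrite /light_ends => /prodf_neq0 /(_ e); rewrite eA te => /(_ isT).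
by rewrite /light pnatr_eq0 eqb0 negbK => /andP.
Qed.

(** Values are rounded up to the right endpoints of the cells, so that a path good on the grid is
    good for the true lengths and costs. *)
Lemma pr_no_cheap_path_le (e1 eta : R) : 0 < e1 <= 1 -> 0 < eta ->
  exists K : R, forall (n : nat) (n2 : (1 < n)%N) (c : R), K <= ln n%:R ->
    ln n%:R ^+ 2 / (2 * n%:R) <= c <= 1 / 2 ->
  pr R (fun u : {ffun edge n -> 'I_(n ^ 2) * 'I_(n ^ 2)} =>
    ~ exists2 p, is_path12 p &
      path_sum (fun e => (u e).2.+1%:R / (n ^ 2)%:R) p <= c /\
      path_sum (fun e => (u e).1.+1%:R / (n ^ 2)%:R) p <=
        (1 + e1) * (ln n%:R ^+ 2 / (4 * c * n%:R))) <= eta.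
Proof.
case/andP => e10 e11 eta0.
(* The exponent 14 adds three losses: 4 from [total], 8 in [L0], and 2 from replacing [l / 2] by
   [m]. *)
have [d [d0 dE]] : exists d : R, 0 < d /\ expR (14 * d) = 1 + e1.
  exists (ln (1 + e1) / 14); split; first by rewrite divr_gt0// ln_gt0 ?ltrDl.
  by rewrite mulrC divfK ?pnatr_eq0// lnK// posrE addr_gt0.
have d14 : d <= 1 / 14 by have := expR_ge1Dx (14 * d); rewrite dE; lra.
have d01 : 0 < d <= 1 / 2 by rewrite d0/=; lra.
have [tau [t0 t2 tauE]] : exists t : R, [/\ 0 < t, t <= 1 / 2 & expR (41 * t) <= 1 + eta].
  exists (Num.min (1 / 2) (ln (1 + eta) / 41)); split.
  - by rewrite lt_min divr_gt0//= divr_gt0// ln_gt0 ?ltrDl.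
  - by rewrite ge_min lexx.
  have : expR (41 * (ln (1 + eta) / 41)) = 1 + eta.
    by rewrite mulrC divfK ?pnatr_eq0// lnK// posrE addr_gt0.
  by move=> E; rewrite -[leRHS]E ler_expR ler_wpM2l// ge_min lexx orbT.
have dt0 : 0 < d ^+ 2 * tau by rewrite mulr_gt0// exprn_gt0.
have K1 : 0 < 2 / d by rewrite divr_gt0.
have K2 : 0 < 128 / (d ^+ 2 * tau) by rewrite divr_gt0.
have K3 : 0 < 6 / tau by rewrite divr_gt0.
exists (8 + 2 / d + 128 / (d ^+ 2 * tau) + 6 / tau) => n n2 c Kl /andP[c_ge c_le].
set l := ln n%:R in Kl c_ge *.
have n0 : 0 < n%:R :> R by rewrite ltr0n ltnW.
have n1 : 1 <= n%:R :> R by rewrite ler1n ltnW.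
have l8 : 8 <= l by lra.
have l0 : 0 < l by lra.
have ld : 2 <= l * d by rewrite -ler_pdivrMr//; lra.
have ldt : 128 <= l * (d ^+ 2 * tau) by rewrite -ler_pdivrMr//; lra.
have lt : 6 <= l * tau by rewrite -ler_pdivrMr//; lra.
clear Kl K1 K2 K3.
have nE : n%:R = expR l by rewrite lnK ?posrE.
have c0 : 0 < c.
  by apply: lt_le_trans c_ge; rewrite divr_gt0 ?exprn_gt0// mulr_gt0.
have cn : l ^+ 2 <= c * (2 * n%:R) by rewrite -ler_pdivrMr// mulr_gt0.
(* [m] is rounded upwards because [n <= e^(2m)] is required. *)
have [m [m_gt m_le]] : exists m : nat, l / 2 < m%:R /\ m%:R <= l / 2 + 1.
  have l2 : 0 <= l / 2 by lra.
  have /andP[h1 h2] := Num.Theory.truncn_itv l2.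
  by exists (Num.truncn (l / 2)).+1; split => //; rewrite -natr1 lerD2r.
have ml : m%:R <= l / 2 * expR d.
  apply: le_trans m_le _; apply: le_trans (_ : l / 2 * (1 + d) <= _); first lra.
  by rewrite ler_wpM2l ?expR_ge1Dx//; lra.
have m0 : 0 < m%:R :> R by lra.
have m2 : m%:R ^+ 2 <= expR (2 * d) * (l ^+ 2 / 4).
  apply: le_trans (_ : (l / 2 * expR d) ^+ 2 <= _).
    by rewrite lerXn2r// nnegrE ?mulr_ge0 ?expR_ge0//; lra.
  rewrite exprMn -expRM_natl mulrC ler_wpM2l ?expR_ge0//.
  by rewrite exprMn le_eqVlt; apply/orP; left; apply/eqP; field.
have nm : n%:R <= expR (2 * m%:R) :> R by rewrite nE ler_expR; lra.
have mdt : 64 <= m%:R * (d ^+ 2 * tau).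
  apply: le_trans (_ : l / 2 * (d ^+ 2 * tau) <= _); first lra.
  by rewrite ler_wpM2r// ltW.
have mn : m.+3%:R ^+ 2 <= tau * n%:R.
  apply: le_trans (_ : l ^+ 2 <= _).
    rewrite lerXn2r ?nnegrE ?ler0n ?(ltW l0)//.
    by rewrite -addn3 natrD; lra.
  apply: le_trans (_ : tau * (l ^+ 3 / 6) <= _).
    have : 0 <= l ^+ 2 * (l * tau - 6) by rewrite mulr_ge0 ?sqr_ge0 ?subr_ge0.
    by rewrite !exprS expr0; lra.
  rewrite ler_wpM2l ?(ltW t0)// nE.
  have := expR_ge1Dxn 2 (ltW l0); rewrite (_ : 3`!%:R = 6)//; lra.
(* [C0] leaves a factor [e^(4d)] of the budget for terminal edges and rounding; [L0] is then forced
   by [n L0 C0 = e^(4d) m^2]. *)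
pose C0 := c * expR (- (4 * d)); pose L0 := expR (8 * d) * m%:R ^+ 2 / (n%:R * c).
have Cp : 0 < C0 by rewrite mulr_gt0 ?expR_gt0.
have Lp : 0 < L0 by rewrite divr_gt0// mulr_gt0 ?expR_gt0// exprn_gt0.
have nLC : n%:R * L0 * C0 = expR (4 * d) * m%:R ^+ 2.
  have -> : n%:R * L0 * C0 = expR (8 * d) * expR (- (4 * d)) * m%:R ^+ 2.
    by rewrite /L0 /C0; field; rewrite !gt_eqF.
  by rewrite -expRD; congr (expR _ * _); ring.
have C01 : 0 < C0 <= 1.
  rewrite Cp/=; apply: le_trans (_ : c * 1 <= _); last by lra.
  by rewrite ler_wpM2l ?(ltW c0)// expR_le1 oppr_le0 mulr_ge0// ltW.
have e10d : expR (10 * d) <= 2.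
  apply: le_trans (_ : expR (14 * d) <= _); last by rewrite dE; lra.
  by rewrite ler_expR ler_wpM2r ?(ltW d0)// ler_nat.
(* The lower bound on the budget enters here: [L0 <= e^(10d) l^2 / (4 n c) <= l^2 / (2 n c) <=
   1]. *)
have L01 : 0 < L0 <= 1.
  rewrite Lp/= ler_pdivrMr ?mul1r; last by rewrite mulr_gt0.
  apply: le_trans (ler_wpM2l (expR_ge0 _) m2) _.
  rewrite [leLHS]mulrA -expRD.
  have -> : 8 * d + 2 * d = 10 * d by ring.
  have : expR (10 * d) * (l ^+ 2 / 4) <= 2 * (l ^+ 2 / 4).
    by rewrite ler_wpM2r// divr_ge0// sqr_ge0.
  lra.
have t01 : 0 < tau <= 1 / 2 by rewrite t0.
apply: le_trans (_ : expR (41 * tau) - 1 <= _); last by lra.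
apply: le_trans (pr_no_light_path_asymp n2 d01 t01 L01 C01 nLC nm mdt mn).
apply: le_pr => u noP [t [ut bt lt1]]; apply: noP.
exists (path_of n2 t); first by rewrite is_path12_path_of.
have e4 : 1 <= expR (4 * d) by apply: le_trans (expR_ge1Dx _); rewrite lerDl mulr_ge0// ltW.
have dm2 : 1 <= d * m%:R ^+ 2.
  have : 64 <= m%:R * d.
    apply: le_trans mdt _; rewrite ler_wpM2l ?(ltW m0)//.
    rewrite expr2 -mulrA ler_piMr ?(ltW d0)//.
    apply: le_trans (_ : 1 * 1 <= _); last by rewrite mulr1.
    by rewrite ler_pM ?ltW//; clear - d14 t2; lra.
  move=> H; apply: le_trans (_ : m%:R * d * 1 <= _); first by clear - H; lra.
  by rewrite expr2 mulrCA mulrA ler_wpM2l ?mulr_ge0 ?ltW//; clear - m_gt l8; lra.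
have slack X Y : 0 < X -> 0 < Y <= 1 -> n%:R * X * Y = expR (4 * d) * m%:R ^+ 2 ->
    m.+2%:R / (n ^ 2)%:R <= d * X.
  move=> X0 /andP[Y0 Y1] nXY.
  have nX : m%:R ^+ 2 <= n%:R * X.
    apply: le_trans (_ : n%:R * X * Y <= _).
      by rewrite nXY ler_peMl// sqr_ge0.
    by rewrite ler_piMr// mulr_ge0// ltW.
  rewrite natrX ler_pdivrMr ?exprn_gt0//.
  apply: le_trans (_ : n%:R * 1 <= _).
    rewrite mulr1; apply: le_trans (_ : tau * n%:R <= _); last first.
      by rewrite ler_piMl ?(ltW n0)//; clear - t2; lra.
    apply: le_trans mn; apply: le_trans (_ : m.+3%:R <= _); first by rewrite ler_nat.
    by rewrite expr2 ler_peMl ?ler0n// ler1n.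
  apply: le_trans (_ : n%:R * (d * (n%:R * X)) <= _); last first.
    by rewrite expr2 le_eqVlt; apply/orP; left; apply/eqP; ring.
  rewrite ler_wpM2l ?(ltW n0)//; apply: le_trans dm2 _.
  by rewrite ler_wpM2l// ltW.
(* The inner edges take [(1 + d) X], the two terminal ones [2 d X], and rounding up [m + 2] edges
   [d X]. *)
have total (X : R) (g : edge n -> nat) : 0 < X -> m.+2%:R / (n ^ 2)%:R <= d * X ->
    (forall e, e \in path_edges (path_of n2 t) -> terminal n2 e -> (g e)%:R / (n ^ 2)%:R <= d * X) ->
    \sum_(e in path_edges (path_of n2 t) | ~~ terminal n2 e) (g e)%:R / (n ^ 2)%:R <= (1 + d) * X ->
    path_sum (fun e => (g e).+1%:R / (n ^ 2)%:R) (path_of n2 t) <= expR (4 * d) * X.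
  move=> X0 sl tm inn; rewrite /path_sum.
  rewrite (eq_bigr (fun e => (g e)%:R / (n ^ 2)%:R + (n ^ 2)%:R^-1)); last first.
    by move=> e _; rewrite -natr1 mulrDl mul1r.
  rewrite big_split/= sumr_const card_path_of// size_tuple.
  apply: le_trans (_ : (1 + 4 * d) * X <= _); last first.
    by rewrite ler_wpM2r ?expR_ge1Dx// ltW.
  have := sum_path_le ut tm.
  rewrite -[(n ^ 2)%:R^-1 *+ _]mulr_natl; clear - sl inn; lra.
have := light_ends1 lt1; case/andP: bt => /andP[_ bw] /andP[_ bc] le1.
split.
  have -> : c = expR (4 * d) * C0.
    by rewrite /C0 mulrCA -expRD subrr expR0 mulr1.
  apply: (total C0 (fun e => (u e).2 : nat)) => //.
  - by apply: (slack C0 L0 Cp L01); rewrite mulrAC.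
  - by move=> e eA te; have [] := le1 e eA te.
apply: le_trans (total L0 (fun e => (u e).1 : nat) Lp _ _ bw) _.
- exact: (slack L0 C0 Lp C01 nLC).
- by move=> e eA te; have [] := le1 e eA te.
rewrite -dE /L0.
have -> : expR (4 * d) * (expR (8 * d) * m%:R ^+ 2 / (n%:R * c)) =
    expR (4 * d) * expR (8 * d) * (m%:R ^+ 2 / (n%:R * c)) by ring.
have -> : 14 * d = 4 * d + 8 * d + 2 * d by ring.
rewrite !expRD -[leRHS]mulrA ler_wpM2l ?mulr_ge0 ?expR_ge0//.
rewrite ler_pdivrMr; last by rewrite mulr_gt0.
apply: le_trans m2 _; rewrite le_eqVlt; apply/orP; left; apply/eqP.
by field; rewrite !gt_eqF.
Qed.

End CheapPath.

(** * Absence of atypical paths *)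

Section RarePaths.
Variable R : realType.

(** With [B = l^2 / (4 c n)], the tilts satisfy [lam f B = mu c = y l / 2]. Then
    [n e^h / (lam mu) = f e^h / y^2 < 1] and the energy is at most [y l - h k l / 2], which leaves a
    negative power of [n]. The sign of [h] decides whether paths with many or with few edges are
    excluded; [h = 0] ignores the count. *)
Lemma pr_rare_paths_le (y f h k eta : R) : 0 < y -> 0 < f ->
  f * expR h < y ^+ 2 -> y - h * k / 2 < 1 -> 0 < eta ->
  exists K : R, forall (n : nat) (n2 : (1 < n)%N) (c : R), K <= ln n%:R ->
    ln n%:R ^+ 2 / (2 * n%:R) <= c <= 1 / 2 ->
  pr R (fun u : {ffun edge n -> 'I_(n ^ 2) * 'I_(n ^ 2)} =>
    exists2 p, is_path12 p &
      [/\ path_sum (grid_c R u) p <= c,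
          path_sum (grid_w R u) p <= f * (ln n%:R ^+ 2 / (4 * c * n%:R)) &
          h * (k * ln n%:R / 2) <= h * #|path_edges p|%:R]) <= eta.
Proof.
move=> y0 f0 fhy ykh eta0.
have y2 : 0 < y ^+ 2 by rewrite exprn_gt0.
have [a0 [a0_ge0 a0_lt1 a0E]] : exists a, [/\ 0 <= a, a < 1 & a = f * expR h / y ^+ 2].
  exists (f * expR h / y ^+ 2); split=> //; last by rewrite ltr_pdivrMr// mul1r.
  by rewrite divr_ge0 ?(ltW y2)// mulr_ge0 ?expR_ge0 ?(ltW f0).
(* Chosen for [a0 (1 + tau)^2 <= a0 + 3 tau = (1 + a0) / 2], which is below 1. *)
have [tau [tau0 tauE]] : exists t, 0 < t /\ t = (1 - a0) / 6.
  by exists ((1 - a0) / 6); split=> //; rewrite divr_gt0// subr_gt0.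
have [g [g0 gE]] : exists t, 0 < t /\ t = 1 - (y - h * k / 2).
  by exists (1 - (y - h * k / 2)); split=> //; rewrite subr_gt0.
have b0 : 0 < 1 - a0 by rewrite subr_gt0.
pose K := 1 + y / (f * tau) + y / tau + 2 / (g * (eta * (1 - a0))).
have K1 : 0 < y / (f * tau) by rewrite divr_gt0 ?mulr_gt0.
have K2 : 0 < y / tau by rewrite divr_gt0.
have K3 : 0 < 2 / (g * (eta * (1 - a0))) by rewrite divr_gt0 ?mulr_gt0.
exists K => n n2 c Kl /andP[c_ge c_le].
set l := ln n%:R in Kl c_ge *.
have n0 : 0 < n%:R :> R by rewrite ltr0n ltnW.
have n1 : 1 <= n%:R :> R by rewrite ler1n ltnW.
have l1 : 1 <= l by apply: le_trans Kl; rewrite /K; lra.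
have l0 : 0 < l by lra.
have c0 : 0 < c by apply: lt_le_trans c_ge; rewrite divr_gt0 ?exprn_gt0 ?mulr_gt0.
have [B [B0 BE]] : exists b, 0 < b /\ b = l ^+ 2 / (4 * c * n%:R).
  by eexists; split; last reflexivity; rewrite divr_gt0 ?exprn_gt0// !mulr_gt0.
rewrite -BE.
have [lam [lam0 lamE]] : exists b, 0 < b /\ b = y * l / (2 * (f * B)).
  by eexists; split; last reflexivity; rewrite divr_gt0 ?mulr_gt0// mulr_gt0.
have [mu [mu0 muE]] : exists b, 0 < b /\ b = y * l / (2 * c).
  by eexists; split; last reflexivity; rewrite divr_gt0 ?mulr_gt0.
have N0 : (0 < n ^ 2)%N by rewrite expn_gt0 ltnW.
(* The two ends of the budget range make the mesh [1 / n^2] fine enough: [c <= 1/2] for [lam], and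
   [l^2 / (2 n) <= c] for [mu]. *)
have lamN : lam / (n ^ 2)%:R <= tau.
  have E1 : lam / (n ^ 2)%:R = 2 * y * c / (f * (l * n%:R)).
    by rewrite lamE BE natrX; field; rewrite !gt_eqF.
  apply: le_trans (_ : y / (f * l) <= _); last first.
    rewrite ler_pdivrMr ?mulr_gt0//.
    have : y / (f * tau) <= l by apply: le_trans Kl; rewrite /K; lra.
    by rewrite ler_pdivrMr ?mulr_gt0//; lra.
  rewrite E1 ler_pdivrMr ?mulr_gt0//.
  have -> : y / (f * l) * (f * (l * n%:R)) = y * n%:R.
    by field; rewrite !gt_eqF.
  have := ler_wpM2l (ltW y0) c_le; have := ler_wpM2l (ltW y0) n1; lra.
have muN : mu / (n ^ 2)%:R <= tau.
  apply: le_trans (_ : y / l <= _); last first.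
    rewrite ler_pdivrMr// mulrC -ler_pdivrMr//.
    by apply: le_trans Kl; rewrite /K; lra.
  have cn : l ^+ 2 <= c * (2 * n%:R) by rewrite -ler_pdivrMr ?mulr_gt0.
  have -> : mu / (n ^ 2)%:R = y * l / (2 * c * n%:R ^+ 2).
    by rewrite muE natrX; field; rewrite !gt_eqF.
  rewrite ler_pdivrMr; last by rewrite mulr_gt0 ?exprn_gt0 ?mulr_gt0.
  have -> : y / l * (2 * c * n%:R ^+ 2) = y * n%:R * (c * (2 * n%:R)) / l.
    by field; rewrite gt_eqF.
  rewrite ler_pdivlMr// -mulrA -mulrA ler_wpM2l ?(ltW y0)// -expr2.
  by apply: le_trans cn _; rewrite ler_peMl ?mulr_ge0// ltW.
set N := (n ^ 2)%N in N0 lamN muN *.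
have NR : 0 < N%:R :> R by rewrite ltr0n.
pose r := n%:R * (expR h * (lam^-1 + N%:R^-1) * (mu^-1 + N%:R^-1)).
have rE : r = a0 * (1 + lam / N%:R) * (1 + mu / N%:R).
  rewrite /r a0E lamE muE BE; field.
  by rewrite !gt_eqF.
have r_le : r <= (1 + a0) / 2.
  rewrite rE; apply: le_trans (_ : a0 * (1 + tau) * (1 + tau) <= _).
    have lN0 : 0 <= lam / N%:R by rewrite divr_ge0 ?ltW.
    have mN0 : 0 <= mu / N%:R by rewrite divr_ge0 ?ltW.
    rewrite ler_pM ?mulr_ge0 ?addr_ge0 ?lerD2l//.
    by rewrite ler_wpM2l ?lerD2l.
  have t1 : tau <= 1 / 6 by rewrite tauE; lra.
  have : a0 * (1 + tau) * (1 + tau) <= a0 * (1 + 3 * tau).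
    by rewrite -mulrA ler_wpM2l//; have := mulr_ge0 (ltW tau0) (ltW tau0); nra.
  have : a0 * tau <= tau by rewrite ler_piMl// ltW.
  by rewrite tauE; lra.
apply: le_trans (_ : expR (y * l - h * (k * l / 2)) / n%:R / (1 - r) <= _).
  apply: le_trans (pr_energy_le n2 N0 _ lam0 mu0 _); last by rewrite -/r; lra.
  apply: le_pr => u [p pp [pc pw pk]]; exists p => //.
  have H1 := ler_wpM2l (ltW lam0) pw; have H2 := ler_wpM2l (ltW mu0) pc.
  have E1 : lam * (f * B) = y * l / 2 by rewrite lamE; field; rewrite !gt_eqF.
  have E2 : mu * c = y * l / 2 by rewrite muE; field; rewrite gt_eqF.
  rewrite E1 in H1; rewrite E2 in H2; lra.
have -> : expR (y * l - h * (k * l / 2)) / n%:R = expR (- (g * l)).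
  have nE : n%:R = expR l by rewrite lnK ?posrE.
  rewrite [X in _ / X]nE -expRN -expRD; congr expR; rewrite gE; ring.
have r2 : (1 - a0) / 2 <= 1 - r by lra.
have a2 : 0 < (1 - a0) / 2 by lra.
rewrite ler_pdivrMr; last by lra.
apply: le_trans (expRN_le _) _; first by rewrite mulr_ge0 ?ltW.
apply: le_trans (_ : eta * ((1 - a0) / 2) <= _); last by rewrite ler_wpM2l// ltW.
have gl : 0 < 1 + g * l by rewrite addr_gt0// mulr_gt0.
rewrite -div1r ler_pdivrMr//.
have Hl : 2 / (g * (eta * (1 - a0))) <= l by apply: le_trans Kl; rewrite /K; lra.
rewrite ler_pdivrMr in Hl; last by rewrite !mulr_gt0// subr_gt0.
have : 0 <= eta * (1 - a0) by rewrite mulr_ge0 ?subr_ge0// ltW.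
lra.
Qed.

End RarePaths.

Local Open Scope classical_set_scope.
Local Open Scope ring_scope.

(** * From the grid to the probability space *)

Lemma uniform_prob_itv (R : realType) (a b : R) : 0 <= a -> a <= b -> b <= 1 ->
  uniform_prob (@ltr01 R) `[a, b[ = (b - a)%:E.
Proof.
move=> a0 ab b1.
rewrite /uniform_prob (eq_integral (fun x => 1%E)).
  rewrite integral_cst//= mul1e lebesgue_measure_itv/= lte_fin.
  case: ltrP => [|]; first by rewrite EFinB.
  by move=> ba; have -> : a = b by [apply/eqP; rewrite eq_le ab]; rewrite subrr.
move=> x; rewrite inE/= in_itv/= => /andP[ax xb].
rewrite /uniform_pdf (le_trans a0 ax) (le_trans (ltW xb) b1)/=.
by rewrite subr0 invr1.
Qed.

Section Transfer.
Variables (R : realType) (d : measure_display) (T : measurableType d).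
Variables (P : probability T R) (E : finType) (w c : E -> {RV P >-> R}).
Hypothesis w_unif : forall e, uniform01 (w e).
Hypothesis c_unif : forall e, uniform01 (c e).
Hypothesis wc_indep : mutually_independent (sum_family w c).
Variable N : nat.
Hypothesis N0 : (0 < N)%N.

(** Half-open, so that the cells are disjoint; the value 1, of probability zero, lies in none. *)
Definition grid_cell (a : 'I_N) : set R :=
  `[a%:R / N%:R, a.+1%:R / N%:R[%classic.

Definition in_cell (u : {ffun E -> 'I_N * 'I_N}) : set T :=
  [set x | forall e, grid_cell (u e).1 (w e x) /\ grid_cell (u e).2 (c e x)].

Let cellA (u : {ffun E -> 'I_N * 'I_N}) (k : E + E) : set R :=
  match k with inl e => grid_cell (u e).1 | inr e => grid_cell (u e).2 end.

Let in_cellE u : in_cell u =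
  \bigcap_(k in [set` [set: E + E]%SET]) (sum_family w c k @^-1` cellA u k).
Proof.
apply/seteqP; split=> x /=.
  by move=> ux [] e _ /=; have [] := ux e.
by move=> ux e; split; [apply: (ux (inl e)) | apply: (ux (inr e))] => /=; rewrite inE.
Qed.

Let measurable_cellA u k : measurable (cellA u k).
Proof. by case: k => e; exact: measurable_itv. Qed.

Lemma measurable_in_cell u : measurable (in_cell u).
Proof.
rewrite in_cellE; apply: fin_bigcap_measurable => [|k _]; first exact: finite_finset.
rewrite -[_ @^-1` _]setTI.
by apply: measurable_funP => //; exact: measurable_cellA.
Qed.

Let prob_cellA u k : P (sum_family w c k @^-1` cellA u k) = (N%:R^-1)%:E.
Proof.
have cell (a : 'I_N) : uniform_prob (@ltr01 R) (grid_cell a) = (N%:R^-1)%:E.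
  rewrite uniform_prob_itv ?divr_ge0// ?ler_wpM2r ?invr_ge0 ?ler0n ?ler_nat//.
    by rewrite -mulrBl -natrB// subSnn mul1r.
  by rewrite ler_pdivrMr ?ltr0n// mul1r ler_nat.
case: k => e /=.
  by rewrite -(cell (u e).1) -(w_unif e)//; exact: measurable_itv.
by rewrite -(cell (u e).2) -(c_unif e)//; exact: measurable_itv.
Qed.

Lemma prob_in_cell u :
  P (in_cell u) = ((#|{ffun E -> 'I_N * 'I_N}|%:R)^-1)%:E.
Proof.
rewrite in_cellE wc_indep; last exact: measurable_cellA.
rewrite (eq_bigr (fun _ => (N%:R^-1)%:E)) => [|k _]; last exact: prob_cellA.
rewrite prodEFin prodr_const; congr (_ %:E).
rewrite cardsT card_sum card_ffun card_prod card_ord natrX natrM.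
by rewrite -expr2 -exprM exprVn mul2n -addnn.
Qed.

Lemma trivIset_in_cell (D : set {ffun E -> 'I_N * 'I_N}) : trivIset D in_cell.
Proof.
move=> u v _ _ [x [ux vx]].
have cell_inj (a b : 'I_N) (t : R) : grid_cell a t -> grid_cell b t -> a = b.
  rewrite /grid_cell /= !in_itv/= => /andP[a1 a2] /andP[b1 b2].
  apply/val_inj/eqP; rewrite eqn_leq.
  have H (i j : nat) : i%:R / N%:R < j%:R / N%:R :> R -> (i < j)%N.
    by rewrite ltr_pM2r ?invr_gt0 ?ltr0n// ltr_nat.
  by apply/andP; split; rewrite -ltnS; apply: H; [apply: le_lt_trans b2|apply: le_lt_trans a2].
apply/ffunP => e; have [u1 u2] := ux e; have [v1 v2] := vx e.
by rewrite [u e]surjective_pairing [v e]surjective_pairing (cell_inj _ _ _ u1 v1) (cell_inj _ _ _ u2 v2).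
Qed.

(** The events [in_cell u] are disjoint and equiprobable, so [pr R Q] is the probability of their
    union over [Q], which [A] contains. *)
Lemma pr_le_prob (Q : {ffun E -> 'I_N * 'I_N} -> Prop) (A : set T) :
  measurable A -> (forall u, Q u -> in_cell u `<=` A) ->
  ((pr R Q)%:E <= P A)%E.
Proof.
move=> mA QA; pose U : finType := {ffun E -> 'I_N * 'I_N}.
pose r := [seq u <- enum U | `[< Q u >]].
have finr : finite_set [set` r] by exact: finite_finset.
have -> : (pr R Q)%:E = P (\bigcup_(u in [set` r]) in_cell u).
  rewrite measure_fin_bigcup//; [|exact: trivIset_in_cell
    |by move=> u _; exact: measurable_in_cell].
  rewrite -fsbig_seq ?filter_uniq -?enumT ?enum_uniq//.
  rewrite (eq_bigr (fun _ => (#|U|%:R^-1)%:E)) => [|u _]; last exact: prob_in_cell.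
  rewrite sumEFin big_filter big_enum_cond/= big_mkcond/= /pr /avg mulr_suml.
  congr (_%:E); apply: eq_bigr => u _.
  by case: asboolP; rewrite ?mul1r ?mul0r.
apply: (le_measure P); rewrite ?inE//.
  by apply: fin_bigcup_measurable => // u _; exact: measurable_in_cell.
move=> x [u /=]; rewrite mem_filter => /andP[/asboolP Qu _] ux.
exact: QA Qu _ ux.
Qed.
End Transfer.

(** * Measurability *)

Lemma measurable_forall (d : measure_display) (T : measurableType d)
    (U : countType) (F : U -> set T) :
  (forall u, measurable (F u)) -> measurable [set x | forall u, F u x].
Proof.
move=> mF; have -> : [set x | forall u, F u x] = ~` \bigcup_u ~` F u.
  rewrite setC_bigcup; apply/seteqP; split=> x /= H u; first by rewrite setCK.
  by have := H u I; rewrite setCK.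
apply: measurableC; apply: countable_bigcupT_measurable => [|u].
  exact: countableP.
exact: measurableC.
Qed.

Section Measurability.
Variables (R : realType) (d : measure_display) (T : measurableType d).
Variables (P : probability T R) (n : nat) (w c : edge n -> {RV P >-> R}).
Variable b : R.

Let W p x := path_sum (fun e => w e x) p.
Let minW x := min_length (fun e => w e x) (fun e => c e x) b.

Lemma measurable_path_sum (X : edge n -> {RV P >-> R}) (p : seq 'I_n) :
  measurable_fun setT (fun x => path_sum (fun e => X e x) p).
Proof.
rewrite (_ : (fun x => _) = fun x =>
    \sum_e if e \in path_edges p then X e x else 0); last first.
  by apply/funext => x; exact: big_mkcond.
by apply: measurable_sum => e; case: (e \in path_edges p); [exact: measurable_funP|exact: measurable_cst].
Qed.

Lemma measurable_feasible p :
  measurable [set x | feasible (fun e => c e x) b p].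
Proof.
case: (boolP (is_path12 p)) => pp; last first.
  rewrite (_ : [set x | _] = set0)//; apply/seteqP; split=> x //= -[].
  by rewrite (negPf pp).
rewrite (_ : [set x | _] = setT `&`
    [set x | ((path_sum (fun e => c e x) p)%:E <= b%:E)%E]).
  apply: measurable_lee => //; apply/measurable_EFinP; first exact: measurable_path_sum.
apply/seteqP; split=> x /=; first by case=> _ H; rewrite lee_fin.
by case=> _; rewrite lee_fin.
Qed.

(** [r] is at most the infimum exactly when every sequence is infeasible or of length at least [r]:
    a countable intersection. *)
Lemma measurable_min_length : measurable_fun setT minW.
Proof.
apply: (measurability _ (ErealGenCInfty.measurableE R)) => // _ [_ [r ->] <-].
rewrite setTI (_ : _ @^-1` _ = [set x | forall p : seq 'I_n,
    (~` [set x | feasible (fun e => c e x) b p] `|`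
     (setT `&` [set x | (r%:E <= (W p x)%:E)%E])) x]).
  apply: measurable_forall => p; apply: measurableU.
    by apply: measurableC; exact: measurable_feasible.
  apply: measurable_lee => //; apply/measurable_EFinP; last exact: measurable_path_sum.
apply/seteqP; split=> x /=; rewrite in_itv/= andbT => H.
  move=> p; case: (pselect (feasible (fun e => c e x) b p)) => fp; [right|by left].
  by split=> //; apply: le_trans H _; apply: ereal_inf_lbound; exists p.
by apply/ereal_infP => _ [p fp <-]; case: (H p) => [//|[]].
Qed.

Lemma measurable_approx_event B K eps : measurable (approx_event w c b B K eps).
Proof.
rewrite (_ : approx_event _ _ _ _ _ _ =
    (setT `&` [set x | (`| minW x * (B^-1)%:E - 1 | <= eps%:E)%E]) `&`
    [set x | forall p : seq 'I_n, (~` ([set x | feasible (fun e => c e x) b p] `&`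
      (setT `&` [set x | ((W p x)%:E = minW x)%E])) `|`
      [set _ | `| #|path_edges p|%:R / K - 1 | <= eps]) x]).
  apply: measurableI.
    apply: measurable_lee => //.
    apply: measurableT_comp => //; apply: emeasurable_funB; last exact: measurable_cst.
    apply: emeasurable_funM; [exact: measurable_min_length|exact: measurable_cst].
  apply: measurable_forall => p; apply: measurableU.
    apply: measurableC; apply: measurableI; first exact: measurable_feasible.
    apply: measurable_eqe => //; last exact: measurable_min_length.
    by apply/measurable_EFinP; exact: measurable_path_sum.
  case: (pselect (`| #|path_edges p|%:R / K - 1 | <= eps)) => H.
    by rewrite (_ : [set _ | _] = setT)//; apply/seteqP; split.
  by rewrite (_ : [set _ | _] = set0)//; apply/seteqP; split.
rewrite setTI; apply/seteqP; split=> x /= -[H1 H2]; split=> // p.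
  case: (pselect (optimal (fun e => w e x) (fun e => c e x) b p)) => op.
    by right; exact: H2.
  by left; move=> [fp [_ mp]]; exact: op.
by case=> fp mp; case: (H2 p) => // -[]; split.
Qed.

End Measurability.

(** * Convergence in probability *)

Section Assembly.
Variable R : realType.

(** For [h = 2 ln y] the condition [y - h y / 2 < 1] reads [g y > 0] with [g = ln y - 1 + 1 / y],
    positive because [e^x > 1 + x] at [x = - ln y]. Half of this gap is spent on lowering [h] by
    [g], which in turn allows lengths up to a factor [1 + e < e^g]. *)
Lemma tilt_exponent (y : R) : 0 < y -> y != 1 ->
  exists g, [/\ 0 < g, (1 < y -> 0 <= 2 * ln y - g), (y < 1 -> 2 * ln y - g <= 0),
    (forall e, e <= g -> (1 + e) * expR (2 * ln y - g) < y ^+ 2) &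
    y - (2 * ln y - g) * y / 2 < 1].
Proof.
move=> y0 y1; have yn0 : y != 0 by rewrite gt_eqF.
have g0 : 0 < ln y - 1 + y^-1.
  have ly : - ln y != 0 by rewrite oppr_eq0 ln_eq0.
  have := expR_gt1Dx ly; rewrite expRN lnK ?posrE//; lra.
exists (ln y - 1 + y^-1); split => //.
- move=> H; have := ln_gt0 H; have : y^-1 <= 1 by rewrite invf_le1// ltW.
  lra.
- move=> H; have : ln y < 0 by rewrite ln_lt0// y0.
  have : 1 <= y^-1 by rewrite invf_ge1// ltW.
  lra.
- move=> e eg; set g := _ + _ in g0 eg *.
  rewrite expRD expRM_natl lnK ?posrE// mulrCA gtr_pMr ?exprn_gt0//.
  rewrite expRN -ltr_pdivlMr ?invr_gt0 ?expR_gt0// invrK mul1r.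
  apply: le_lt_trans (expR_gt1Dx _); first by rewrite lerD2l.
  by rewrite gt_eqF.
have : (ln y - 1 + y^-1) * y = ln y * y - y + 1 by field.
have : 0 < (ln y - 1 + y^-1) * y by rewrite mulr_gt0.
lra.
Qed.

(** Four bad events get probability at most [eta / 4] each: a feasible path that is too short, one
    of length at most [(1 + e') B] with too many edges, one with too few, and the absence of any
    feasible path of length at most [(1 + e') B]. *)
Lemma approx_event_prob_ge (eps eta : R) : 0 < eps < 1 -> 0 < eta ->
  exists K : R, forall (n : nat) (d : measure_display) (T : measurableType d)
    (P : probability T R) (w c : edge n -> {RV P >-> R}) (b : R),
  (1 < n)%N -> (forall e, uniform01 (w e)) -> (forall e, uniform01 (c e)) ->
  mutually_independent (sum_family w c) -> K <= ln n%:R ->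
  ln n%:R ^+ 2 / (2 * n%:R) <= b <= 1 / 2 ->
  ((1 - eta)%:E <= P (approx_event w c b (ln n%:R ^+ 2 / (4 * b * n%:R))
     (ln n%:R / 2) eps))%E.
Proof.
case/andP => e0 e1 eta0.
have eta4 : 0 < eta / 4 by rewrite divr_gt0.
have yu0 : 0 < 1 + eps by lra.
have yl0 : 0 < 1 - eps by lra.
have yu1 : 1 + eps != 1 by rewrite gt_eqF//; lra.
have yl1 : 1 - eps != 1 by rewrite lt_eqF//; lra.
have [gu [gu0 /(_ _)hu _ fu xu]] := tilt_exponent yu0 yu1.
have [gl [gl0 _ /(_ _)hl fl xl]] := tilt_exponent yl0 yl1.
(* The length window has to be narrow enough, by [gu] and [gl], for edge counts off by a factor
   [1 + eps] or [1 - eps] to be ruled out. *)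
pose e' := Num.min eps (Num.min gu gl).
have e'0 : 0 < e' by rewrite !lt_min e0 gu0.
have e'e : e' <= eps by rewrite ge_min lexx.
have e'gu : e' <= gu by rewrite !ge_min lexx !orbT.
have e'gl : e' <= gl by rewrite !ge_min lexx !orbT.
have f'0 : 0 < 1 + e' by lra.
(* Without a tilt on the count, any positive [y < 1] with [1 - eps < y^2] serves. *)
have y1 : 0 < 1 - eps / 4 by lra.
have f1 : (1 - eps) * expR 0 < (1 - eps / 4) ^+ 2.
  by rewrite expR0 mulr1; have := sqr_ge0 eps; rewrite expr2 expr2; lra.
have x1 : (1 - eps / 4) - 0 * 0 / 2 < 1 by rewrite !mul0r; lra.
have [K1 HK1] := pr_rare_paths_le y1 yl0 f1 x1 eta4.
have [K2 HK2] := pr_rare_paths_le yu0 f'0 (fu _ e'gu) xu eta4.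
have [K3 HK3] := pr_rare_paths_le yl0 f'0 (fl _ e'gl) xl eta4.
have e'1 : 0 < e' <= 1 by rewrite e'0/=; lra.
have [K4 HK4] := pr_no_cheap_path_le e'1 eta4.
exists (1 + `|K1| + `|K2| + `|K3| + `|K4|) => n d T P w c b n2 wu cu ind Kl bb.
have := ler_norm K1; have := ler_norm K2; have := ler_norm K3; have := ler_norm K4.
have := normr_ge0 K1; have := normr_ge0 K2; have := normr_ge0 K3; have := normr_ge0 K4.
move=> k1 k2 k3 k4 k5 k6 k7 k8.
have [[l0 Kl1] [Kl2 [Kl3 Kl4]]] : (0 < ln n%:R :> R /\ K1 <= ln n%:R) /\
    K2 <= ln n%:R /\ K3 <= ln n%:R /\ K4 <= ln n%:R.
  by clear - k1 k2 k3 k4 k5 k6 k7 k8 Kl; do !split; lra.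
clear k1 k2 k3 k4 k5 k6 k7 k8 Kl.
have {HK1} HK1 := HK1 n n2 b Kl1 bb.
have {HK2} HK2 := HK2 n n2 b Kl2 bb.
have {HK3} HK3 := HK3 n n2 b Kl3 bb.
have {HK4} HK4 := HK4 n n2 b Kl4 bb.
clear Kl1 Kl2 Kl3 Kl4.
set l := ln n%:R in HK1 HK2 HK3 HK4 l0 bb *.
have nR : 0 < n%:R :> R by rewrite ltr0n ltnW.
have b0 : 0 < b.
  by case/andP: bb => bge _; apply: lt_le_trans bge; rewrite divr_gt0 ?exprn_gt0// mulr_gt0.
have [B [B0 BE]] : exists B, 0 < B /\ B = l ^+ 2 / (4 * b * n%:R).
  by eexists; split; last reflexivity; rewrite divr_gt0 ?exprn_gt0// !mulr_gt0.
rewrite -BE in HK1 HK2 HK3 HK4 *.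
have N0 : (0 < n ^ 2)%N by rewrite expn_gt0 ltnW.
set Q1 := (fun u => exists2 p, _ & _) in HK1.
set Q2 := (fun u => exists2 p, _ & _) in HK2.
set Q3 := (fun u => exists2 p, _ & _) in HK3.
set Q4 := (fun u => ~ _) in HK4.
pose Q u := ~ (Q1 u \/ Q2 u \/ Q3 u \/ Q4 u).
apply: le_trans (_ : ((pr R Q)%:E <= _)%E).
  rewrite lee_fin (prC R); last by rewrite card_ffun card_prod card_ord expn_gt0 muln_gt0 N0.
  rewrite lerB//; apply: le_trans (_ : pr R (fun u => Q1 u \/ Q2 u \/ Q3 u \/ Q4 u) <= _).
    by apply: le_pr => u /contrapT.
  have := prU R Q1 (fun u => Q2 u \/ Q3 u \/ Q4 u).
  have := prU R Q2 (fun u => Q3 u \/ Q4 u).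
  have := prU R Q3 Q4.
  clear - HK1 HK2 HK3 HK4; lra.
apply: (pr_le_prob wu cu ind N0); first exact: measurable_approx_event.
move=> u Qu x ux.
have nQ1 : ~ Q1 u by move=> q; apply: Qu; left.
have nQ2 : ~ Q2 u by move=> q; apply: Qu; right; left.
have nQ3 : ~ Q3 u by move=> q; apply: Qu; right; right; left.
have /contrapT[p0 pp0 [pc0 pw0]] : ~ Q4 u by move=> q; apply: Qu; right; right; right.
(* Left endpoints bound the true values from below, to exclude rare paths; right endpoints bound
   them from above, for the cheap path [p0]. *)
have wlo p : path_sum (grid_w R u) p <= path_sum (fun e => w e x) p.
  by apply: ler_sum => e _; have [] := ux e; rewrite /grid_cell/= in_itv/= => /andP[].
have clo p : path_sum (grid_c R u) p <= path_sum (fun e => c e x) p.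
  by apply: ler_sum => e _; have [] := ux e; rewrite /grid_cell/= !in_itv/= => _ /andP[].
have feas0 : feasible (fun e => c e x) b p0.
  split=> //; apply: le_trans pc0; apply: ler_sum => e _.
  by have [] := ux e; rewrite /grid_cell/= !in_itv/= => _ /andP[_ /ltW].
have w0 : path_sum (fun e => w e x) p0 <= (1 + e') * B.
  apply: le_trans pw0; apply: ler_sum => e _.
  by have [] := ux e; rewrite /grid_cell/= !in_itv/= => /andP[_ /ltW].
have min_le : (min_length (fun e => w e x) (fun e => c e x) b <= ((1 + e') * B)%:E)%E.
  apply: le_trans (_ : ((path_sum (fun e => w e x) p0)%:E <= _)%E); last by rewrite lee_fin.
  by apply: ereal_inf_lbound; exists p0.
have min_ge : (((1 - eps) * B)%:E <= min_length (fun e => w e x) (fun e => c e x) b)%E.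
  apply/ereal_infP => _ [p [pp pc] <-]; rewrite lee_fin; apply: le_trans (wlo p).
  rewrite leNgt; apply/negP => H; apply: nQ1; exists p => //.
  by split; [exact: le_trans (clo p) pc|exact: ltW|rewrite !mul0r].
split.
  move: min_le min_ge; case: (min_length _ _ _) => [r| |]//=.
  rewrite !lee_fin => r_le r_ge.
  have H1 : r / B <= 1 + e' by rewrite ler_pdivrMr.
  have H2 : 1 - eps <= r / B by rewrite ler_pdivlMr.
  rewrite ler_norml; clear - H1 H2 e'e; lra.
move=> p [[pp pc] pmin].
have pw : path_sum (grid_w R u) p <= (1 + e') * B.
  by apply: le_trans (wlo p) _; rewrite -lee_fin pmin.
have pc' := le_trans (clo p) pc.
have l2 : 0 < l / 2 by rewrite divr_gt0.
have up : #|path_edges p|%:R <= (1 + eps) * (l / 2).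
  rewrite leNgt; apply/negP => H; apply: nQ2; exists p => //; split=> //.
  by rewrite ler_wpM2l ?hu//; clear - H e0; lra.
have lo : (1 - eps) * (l / 2) <= #|path_edges p|%:R.
  rewrite leNgt; apply/negP => H; apply: nQ3; exists p => //; split=> //.
  by rewrite ler_wnM2l ?hl//; clear - H e0; lra.
have H1 : #|path_edges p|%:R / (l / 2) <= 1 + eps by rewrite ler_pdivrMr.
have H2 : 1 - eps <= #|path_edges p|%:R / (l / 2) by rewrite ler_pdivlMr.
rewrite ler_norml; clear - H1 H2; lra.
Qed.

End Assembly.

(** * Letting the tolerance tend to zero *)

Lemma diagonal_sequence (q : nat -> nat -> Prop) :
  (forall j, \forall n \near \oo, q n j) ->
  exists J : nat -> nat,
    (forall j, \forall n \near \oo, (j <= J n)%N) /\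
    \forall n \near \oo, q n (J n).
Proof.
move=> qn; pose A n := [pred j : 'I_n.+1 | `[< q n j >]].
(* The largest [j <= n] with [q n j], or 0 if there is none; the latter occurs for finitely many [n]
   only, by the hypothesis at [j = 0]. *)
pose J n := (\max_(j in A n) j)%N.
have JP n j : (j <= n)%N -> q n j -> (j <= J n)%N /\ q n (J n).
  rewrite -ltnS => jn qnj.
  have jA : Ordinal jn \in A n by apply/asboolP.
  split; first by rewrite /J (bigD1 (Ordinal jn))//= leq_maxl.
  have [|i] := @eq_bigmax_cond _ (A n) (fun j : 'I_n.+1 => nat_of_ord j).
    by apply/card_gt0P; exists (Ordinal jn).
  by move=> /asboolP qi; rewrite /J => ->.
exists J; split=> [j|].
  near=> n; apply: (proj1 (JP n j _ _)); first by near: n; exact: nbhs_infty_ge.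
  by near: n; exact: qn.
near=> n; apply: (proj2 (JP n 0%N _ _)) => //.
by near: n; exact: qn.
Unshelve. all: by end_near.
Qed.

Lemma near_ln_ge (R : realType) (K : R) : \forall n \near \oo, K <= ln n%:R :> R.
Proof.
near=> n.
have Kn : expR K <= n%:R.
  apply: le_trans (_ : (Num.truncn (expR K)).+1%:R <= _); first exact/ltW/truncnS_gt.
  by rewrite ler_nat; near: n; exact: nbhs_infty_ge.
rewrite -[K]expRK ler_ln ?posrE ?expR_gt0//.
exact: lt_le_trans (expR_gt0 _) Kn.
Unshelve. all: by end_near.
Qed.

Theorem theorem1 (R : realType)
    (d : nat -> measure_display) (T : forall n : nat, measurableType (d n))
    (P : forall n : nat, probability (T n) R)
    (w c : forall n : nat, edge n -> {RV (P n) >-> R})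
    (c0 : nat -> R)
    (w_unif : forall (n : nat) (e : edge n), uniform01 (w n e))
    (c_unif : forall (n : nat) (e : edge n), uniform01 (c n e))
    (wc_indep : forall n : nat,
       mutually_independent (sum_family (w n) (c n)))
    (c0_range : \forall n \near \oo,
       1 / Num.sqrt 2 * (ln n%:R ^+ 2 / n%:R) <= c0 n <= 1 / (2 * Num.sqrt 2)) :
  exists eps : nat -> R,
    eps n @[n --> \oo] --> 0 /\
    P n (approx_event (w n) (c n) (c0 n)
           (ln n%:R ^+ 2 / (4 * c0 n * n%:R)) (ln n%:R / 2) (eps n))
      @[n --> \oo] --> 1%E.
Proof.
(* The shift by 2 keeps the tolerance strictly between 0 and 1. *)
pose a (j : nat) : R := j.+2%:R^-1.
have a0 j : 0 < a j by rewrite invr_gt0.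
have a1 j : a j < 1 by rewrite invf_lt1 ?ltr1n.
pose event n e := approx_event (w n) (c n) (c0 n)
  (ln n%:R ^+ 2 / (4 * c0 n * n%:R)) (ln n%:R / 2) e.
(* The range used so far is wider than the given one, because [1 <= sqrt 2 <= 2]. *)
have budget : \forall n \near \oo, ln n%:R ^+ 2 / (2 * n%:R) <= c0 n <= 1 / 2.
  have s0 : 0 < Num.sqrt 2 :> R by rewrite sqrtr_gt0.
  have s2 : Num.sqrt 2 ^+ 2 = 2 :> R by rewrite sqr_sqrtr.
  have s1 : 1 <= Num.sqrt 2 :> R by rewrite -[leLHS]sqrtr1 ler_sqrt// ler1n.
  have s3 : Num.sqrt 2 <= 2 :> R.
    by rewrite -[leRHS]s2 expr2 ler_peMl// ltW.
  near=> n.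
  have : 1 / Num.sqrt 2 * (ln n%:R ^+ 2 / n%:R) <= c0 n <= 1 / (2 * Num.sqrt 2).
    by near: n.
  case/andP => h1 h2; apply/andP; split.
    apply: le_trans h1; rewrite div1r invfM mulrCA ler_wpM2r ?divr_ge0 ?sqr_ge0//.
    by rewrite lef_pV2 ?posrE.
  apply: le_trans h2 _; rewrite !div1r lef_pV2 ?posrE ?mulr_gt0//.
  by rewrite ler_peMr.
(* One sequence serves both as tolerance and as bound on the failure probability. *)
have [J [Jge JP]] : exists J : nat -> nat, (forall j, \forall n \near \oo, (j <= J n)%N) /\
    \forall n \near \oo, ((1 - a (J n))%:E <= P n (event n (a (J n))))%E.
  apply: (diagonal_sequence (q := fun n j => ((1 - a j)%:E <= P n (event n (a j)))%E)) => // j.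
  have aj : 0 < a j < 1 by rewrite a0 a1.
  have [K HK] := approx_event_prob_ge aj (a0 j).
  near=> n; apply: HK (w_unif n) (c_unif n) (wc_indep n) _ _.
  - by near: n; exact: nbhs_infty_ge.
  - by near: n; exact: near_ln_ge.
  - by near: n.
have aJ : a (J n) @[n --> \oo] --> 0.
  apply/cvgrPdist_le => e e0; near=> n.
  rewrite sub0r normrN gtr0_norm//.
  pose j := Num.truncn e^-1.
  apply: le_trans (_ : a j <= _).
    rewrite lef_pV2 ?posrE// ler_nat !ltnS.
    by near: n; exact: Jge.
  rewrite -[leRHS]invrK lef_pV2 ?posrE ?invr_gt0//.
  by apply: le_trans (ltW (truncnS_gt _)) _; rewrite ler_nat.
exists (fun n => a (J n)); split=> //.
apply: (@squeeze_cvge _ _ _ _ (fun n => (1 - a (J n))%:E) _ (fun _ => 1%E)).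
- near=> n; apply/andP; split; first by near: n.
  exact: probability_le1 (measurable_approx_event _ _ _ _ _ _).
- rewrite -[X in _ --> X%:E]subr0; apply: cvg_EFin; first by near=> n.
  by apply: cvgB => //; exact: cvg_cst.
- exact: cvg_cst.
Unshelve. all: by end_near.
Qed.
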